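(* Let $a\ge1$ and $m\ge3$ be integers. (1) If $m$ is even, then $\mathcal C_m^{(a)}$ is a lattice Gorenstein polytope of dimension $am$ and codegree $2a+1$. Hence $$\operatorname{Ehr}_{\mathcal C_m^{(a)}}(z)=\frac{h_{m,a}^{*,\mathrm{cyc}}(z)}{(1-z)^{am+1}},$$ where $h_{m,a}^{*,\mathrm{cyc}}(z)$ is a palindromic polynomial of degree $a(m-2)$ whose coefficient sequence is unimodal. Moreover, $$L_{m,\mathrm{cyc}}^{(a)}(-q)=(-1)^{am}L_{m,\mathrm{cyc}}^{(a)}\bigl(q-(2a+1)\bigr)$$ as an identity of Ehrhart polynomials. (2) If $m$ is odd, then $\mathcal C_m^{(a)}$ has denominator exactly $2$. Its Ehrhart counting function is a quasipolynomial of period dividing $2$, and $$L_{m,\mathrm{cyc}}^{(a)}(-q)=(-1)^{am}L_{m,\mathrm{cyc}}^{(a)}\bigl(q-(2a+1)\bigr)$$ as an identity of quasipolynomials. More precisely, restricted to each residue class of $q$ modulo $2$, both sides are polynomials in $q$ that agree for all integers $q\ge2a+1$ in that class, hence they are equal as polynomials.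
   Context: For integers $a\ge1$, $m\ge3$ let $x=(x_{i,j})_{1\le i\le m,\,1\le j\le a}\in\mathbb R^{am}$ and $R_i=x_{i,1}+\cdots+x_{i,a}$. The cyclic block polytope is $\mathcal C_m^{(a)}=\{x\in\mathbb R_{\ge0}^{am}: R_i+R_{i+1}\le1,\ i\in\mathbb Z/m\mathbb Z\}$ (indices read cyclically). For integers $q\ge0$, $L_{m,\mathrm{cyc}}^{(a)}(q)=\#(q\,\mathcal C_m^{(a)}\cap\mathbb Z^{am})$; values at negative arguments are those of the Ehrhart (quasi)polynomial extending this function. $\operatorname{Ehr}_{\mathcal C_m^{(a)}}(z)=\sum_{q\ge0}L_{m,\mathrm{cyc}}^{(a)}(q)z^q$. The denominator of a rational polytope is the least positive integer $k$ such that $kP$ has integral vertices. The codegree of a full-dimensional lattice polytope $P$ is the least positive integer $c$ such that the interior of $cP$ contains a lattice point. A full-dimensional lattice polytope $P$ is Gorenstein of codegree $c$ if $cP$ has a unique interior lattice point $p$ and $cP-p$ is reflexive (all facets are given by $\langle n,y\rangle\le1$ with $n$ a primitive integral vector). A polynomial $h$ of degree $s$ is palindromic if $h(z)=z^sh(1/z)$. *)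

(* Defs.v *)
From HB Require Import structures.
From mathcomp Require Import all_boot all_order all_algebra finmap.
From mathcomp Require Import all_classical all_reals all_analysis.

Set Implicit Arguments.
Unset Strict Implicit.
Unset Printing Implicit Defensive.

Import Order.TTheory GRing.Theory Num.Theory.
Import numFieldNormedType.Exports.

Local Open Scope classical_set_scope.
Local Open Scope ring_scope.

(* The ambient space R^(r*s) is the space 'M[R]_(r, s), with its library      *)
(* topology (that of the sup norm) and vector space structure.                *)

Section Polytopes.
Context {R : realType} {r s : nat}.
Implicit Types (P F : set 'M[R]_(r, s)) (u x y v : 'M[R]_(r, s)).

Definition dotp u x : R := \sum_i \sum_j u i j * x i j.

Definition dilate (k : nat) P : set 'M[R]_(r, s) := [set k%:R *: x | x in P].

Definition translate v P : set 'M[R]_(r, s) := [set x + v | x in P].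

Definition lattice : set 'M[R]_(r, s) := [set x | x \is a mxOver Num.int].

Definition int_mx (n : 'M[int]_(r, s)) : 'M[R]_(r, s) := map_mx intr n.

(* Clearing denominators, the finitely many rational inequalities cutting out *)
(* a rational polytope can be taken with integral coefficients.               *)
Definition rational_polytope P : Prop :=
  bounded_set P /\
  exists ineqs : seq ('M[int]_(r, s) * int),
    P = [set x | forall nc, nc \in ineqs -> dotp (int_mx nc.1) x <= nc.2%:~R].

Definition affine_dim P (d : nat) : Prop :=
  P !=set0 /\
  exists U : {vspace 'M[R]_(r, s)},
    [/\ forall x y, P x -> P y -> x - y \in U,
        forall W : {vspace 'M[R]_(r, s)},
          (forall x y, P x -> P y -> x - y \in W) -> (U <= W)%VS
      & \dim U = d].

Definition full_dimensional P : Prop := affine_dim P (r * s)%N.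

Definition face P F : Prop :=
  exists u (c : R),
    (forall x, P x -> dotp u x <= c) /\ F = [set x | P x /\ dotp u x = c].

Definition vertex P v : Prop := face P [set v].

Definition facet P F : Prop :=
  face P F /\ exists d, affine_dim F d /\ affine_dim P d.+1.

Definition lattice_polytope P : Prop :=
  rational_polytope P /\ forall v, vertex P v -> lattice v.

Definition denominator P (k : nat) : Prop :=
  [/\ rational_polytope P, (0 < k)%N, lattice_polytope (dilate k P)
    & forall k', (0 < k')%N -> lattice_polytope (dilate k' P) -> (k <= k')%N].

Definition codegree P (c : nat) : Prop :=
  [/\ lattice_polytope P, full_dimensional P, (0 < c)%N,
      (interior (dilate c P) `&` lattice) !=set0
    & forall c', (0 < c')%N ->
        (interior (dilate c' P) `&` lattice) !=set0 -> (c <= c')%N].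

Definition primitive_mx (n : 'M[int]_(r, s)) : Prop :=
  \big[gcdn/0%N]_i \big[gcdn/0%N]_j `|n i j|%N = 1%N.

Definition reflexive_polytope P : Prop :=
  forall F, facet P F ->
    exists n : 'M[int]_(r, s),
      [/\ primitive_mx n,
          forall y, P y -> dotp (int_mx n) y <= 1
        & F = [set y | P y /\ dotp (int_mx n) y = 1]].

Definition gorenstein P (c : nat) : Prop :=
  [/\ lattice_polytope P, full_dimensional P, (0 < c)%N
    & exists p, interior (dilate c P) `&` lattice = [set p] /\
                reflexive_polytope (translate (- p) (dilate c P))].

(* [fset_set] is the library's junk value [fset0] on infinite sets; this is   *)
(* harmless since a bounded set has finitely many lattice points.             *)
Definition ehrhart_count P (q : nat) : nat :=
  #|` fset_set (dilate q P `&` lattice) |%fset.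

End Polytopes.

(* Formal power series over rat are given by their coefficient sequences.     *)
Definition ps_mul (f g : nat -> rat) : nat -> rat :=
  fun n => \sum_(i < n.+1) f i * g (n - i)%N.

Definition ps_of_poly (p : {poly rat}) : nat -> rat := fun n => p`_n.

Definition ehrhart_series (R : realType) (r s : nat) (P : set 'M[R]_(r, s)) :
  nat -> rat := fun q => (ehrhart_count P q)%:R.

(* [f = p / d] in rat[[z]], for a denominator d with d(0) != 0 *)
Definition ps_eq_frac (f : nat -> rat) (p d : {poly rat}) : Prop :=
  d`_0 != 0 /\ ps_mul f (ps_of_poly d) = ps_of_poly p.

Definition ehrhart_polynomial (R : realType) (r s : nat)
    (P : set 'M[R]_(r, s)) (f : {poly rat}) : Prop :=
  forall q : nat, f.[q%:R] = (ehrhart_count P q)%:R.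

(* quasipolynomial functions of period dividing k > 0 *)
Definition quasipolynomial (k : nat) (f : int -> rat) : Prop :=
  exists c : int -> {poly rat},
    forall z : int, f z = (c (z %% k%:Z)%Z).[z%:~R].

Definition palindromic (h : {poly rat}) : Prop :=
  forall z : rat, z != 0 -> h.[z] = z ^+ (size h).-1 * h.[z^-1].

Definition unimodal (h : {poly rat}) : Prop :=
  exists k : nat,
    (forall i j : nat, (i <= j <= k)%N -> (j < size h)%N -> h`_i <= h`_j) /\
    (forall i j : nat, (k <= i <= j)%N -> (j < size h)%N -> h`_j <= h`_i).

Definition row_sum (R : realType) (m a : nat) (x : 'M[R]_(m, a))
    (i : 'I_m) : R :=
  \sum_j x i j.

(* [ordS i] is i + 1 modulo m. *)
Definition cyclic_block_polytope (R : realType) (m a : nat) :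
    set 'M[R]_(m, a) :=
  [set x : 'M[R]_(m, a) |
    (forall i j, 0 <= x i j) /\
    (forall i : 'I_m, row_sum x i + row_sum x (ordS i) <= 1)].
Arguments cyclic_block_polytope : clear implicits.

Definition L_cyc (R : realType) (m a : nat) (q : nat) : nat :=
  ehrhart_count (cyclic_block_polytope R m a) q.
Arguments L_cyc : clear implicits.

(* Main.v *)
(** Put the entry (i, k) of a lattice point x of the q-th dilate into the slot
    2 (x_{i,0} + ... + x_{i,k}) + k among the slots 0, ..., 2N - 1, N = q + a.
    Slots then increase along each row with alternating parity, and the last
    slots of two neighbouring rows sum to less than 2N - 1.  Reading the slots
    in order, the sets of entries met so far form a chain of order ideals, whose
    steps alternately add elements of two types: L(q) is a number of walks.
    For m even the odd rows are reflected (slot t becomes 2N - 1 - t) and all 2N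
    slots are read; for m odd an entry and its reflection are both kept and only
    the first N slots are read.

    Weighting the steps of one type by t^(number of added elements) gives
    operators E(t) with E(s) E(t) = E(s + t).  So E(1)^-1 = E(-1) is E(1)
    conjugated by (-1)^|S|: running the walks backwards yields the reciprocity,
    and unipotence yields the (quasi)polynomiality.

    For unimodality (after Branden's work on sign-graded posets) group the steps
    of a walk into maximal blocks of the same type.  A block adding b elements
    contributes an Eulerian polynomial of degree b - 1, so the numerator of the
    Ehrhart series is a sum of products of Eulerian polynomials, and all of them
    are symmetric and unimodal about the same centre.

    Vertices are integral (half-integral for m odd) because a non-integral value
    of the partial sums could be moved up and down within the polytope. *)

Require Import Defs.
From HB Require Import structures.
From mathcomp Require Import all_boot all_order all_algebra finmap.
From mathcomp Require Import all_classical all_reals all_analysis.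
From mathcomp Require Import ring lra zify.

Import Order.TTheory GRing.Theory Num.Theory.
Import numFieldNormedType.Exports.

Set Implicit Arguments.
Unset Strict Implicit.
Unset Printing Implicit Defensive.

Local Open Scope ring_scope.

(** * Formal power series *)

(** A type of its own for coefficient sequences, so that its ring product is the Cauchy product. *)
Record ps := PS { ps_coef : nat -> rat }.

HB.instance Definition _ := gen_eqMixin ps.
HB.instance Definition _ := gen_choiceMixin ps.

Lemma ps_ext (f g : ps) : (forall n, ps_coef f n = ps_coef g n) -> f = g.
Proof. by case: f g => f [g] /= fg; congr PS; exact/funext. Qed.

Definition ps_zero := PS (fun=> 0).
Definition ps_opp f := PS (fun n => - ps_coef f n).
Definition ps_add f g := PS (fun n => ps_coef f n + ps_coef g n).

Fact ps_addA : associative ps_add.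
Proof. by move=> f g h; apply: ps_ext => n /=; rewrite addrA. Qed.
Fact ps_addC : commutative ps_add.
Proof. by move=> f g; apply: ps_ext => n /=; rewrite addrC. Qed.
Fact ps_add0 : left_id ps_zero ps_add.
Proof. by move=> f; apply: ps_ext => n /=; rewrite add0r. Qed.
Fact ps_addN : left_inverse ps_zero ps_opp ps_add.
Proof. by move=> f; apply: ps_ext => n /=; rewrite addNr. Qed.

HB.instance Definition _ :=
  GRing.isZmodule.Build ps ps_addA ps_addC ps_add0 ps_addN.

Definition ps_poly (p : {poly rat}) := PS (fun n => p`_n).
Definition ps_conv f g := PS (ps_mul (ps_coef f) (ps_coef g)).
Definition ps_trunc N (f : ps) : {poly rat} := \poly_(i < N) ps_coef f i.

(** Coefficients up to [n] of a product depend only on those of the factors up to [n]; the ring laws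
    are therefore inherited from truncated polynomials. *)
Lemma ps_conv_trunc N n f g : (n < N)%N ->
  ps_coef (ps_conv f g) n = (ps_trunc N f * ps_trunc N g)`_n.
Proof.
move=> nN; rewrite coefM; apply: eq_bigr => i _.
have iN : (i < N)%N by rewrite (leq_trans _ nN).
by rewrite !coef_poly iN (leq_ltn_trans (leq_subr _ _) nN).
Qed.

Lemma ps_trunc_conv N n f g : (n < N)%N ->
  (ps_trunc N (ps_conv f g))`_n = (ps_trunc N f * ps_trunc N g)`_n.
Proof. by move=> nN; rewrite coef_poly nN; exact: ps_conv_trunc. Qed.

Fact ps_convC : commutative ps_conv.
Proof.
by move=> f g; apply: ps_ext => n; rewrite !(@ps_conv_trunc n.+1) // mulrC.
Qed.

Fact ps_convA : associative ps_conv.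
Proof.
move=> f g h; apply: ps_ext => n; rewrite !(@ps_conv_trunc n.+1) //.
transitivity (ps_trunc n.+1 f * ps_trunc n.+1 g * ps_trunc n.+1 h)`_n.
  rewrite -mulrA !coefM; apply: eq_bigr => i _; congr (_ * _).
  by rewrite ps_trunc_conv // ltnS leq_subr.
by rewrite !coefM; apply: eq_bigr => i _; rewrite ps_trunc_conv.
Qed.

Fact ps_conv1 : left_id (ps_poly 1) ps_conv.
Proof.
move=> f; apply: ps_ext => n; rewrite /= /ps_mul big_ord_recl /= subn0.
rewrite coef1 mul1r big1 ?addr0 // => i _.
by rewrite coef1 mul0r.
Qed.

Fact ps_convDl : left_distributive ps_conv ps_add.
Proof.
move=> f g h; apply: ps_ext => n; rewrite /= /ps_mul -big_split /=.
by apply: eq_bigr => i _; rewrite mulrDl.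
Qed.

Fact ps_one_neq0 : ps_poly 1 != 0.
Proof.
apply/eqP => /(congr1 (fun f => ps_coef f 0)) /=.
by rewrite coef1 => /eqP; rewrite oner_eq0.
Qed.

HB.instance Definition _ := GRing.Zmodule_isComNzRing.Build ps
  ps_convA ps_convC ps_conv1 ps_convDl ps_one_neq0.

Fact ps_poly_is_zmod_morphism : zmod_morphism ps_poly.
Proof. by move=> p q; apply: ps_ext => n /=; rewrite coefB. Qed.
HB.instance Definition _ :=
  GRing.isZmodMorphism.Build {poly rat} ps ps_poly ps_poly_is_zmod_morphism.

Fact ps_poly_is_monoid_morphism : monoid_morphism ps_poly.
Proof. by split=> [|p q] //; apply: ps_ext => n /=; rewrite coefM. Qed.
HB.instance Definition _ :=
  GRing.isMonoidMorphism.Build {poly rat} ps ps_poly ps_poly_is_monoid_morphism.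

Lemma ps_coefD f g n : ps_coef (f + g) n = ps_coef f n + ps_coef g n.
Proof. by []. Qed.

Lemma ps_coef_sum (I : Type) (r : seq I) (P : pred I) (F : I -> ps) n :
  ps_coef (\sum_(i <- r | P i) F i) n = \sum_(i <- r | P i) ps_coef (F i) n.
Proof. by elim/big_rec2: _ => //= i y1 y2 _ <-. Qed.

Definition psX := ps_poly 'X.

Lemma ps_coefXM f n : ps_coef (psX * f) n = if n is k.+1 then ps_coef f k else 0.
Proof.
case: n => [|n]; first by rewrite /= /ps_mul big_ord1 coefX mul0r.
rewrite /= /ps_mul 2!big_ord_recl /= !coefX /= mul0r add0r mul1r subSS subn0.
by rewrite big1 ?addr0 // => i _; rewrite coefX mul0r.
Qed.

Lemma ps_coefXnM k f n :
  ps_coef (psX ^+ k * f) n = if (n < k)%N then 0 else ps_coef f (n - k).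
Proof.
elim: k n => [|k IHk] n; first by rewrite mul1r subn0.
by rewrite exprS -mulrA ps_coefXM; case: n => //= n; rewrite IHk.
Qed.

Definition ps_geo := PS (fun=> 1).

Lemma ps_geoK : (1 - psX) * ps_geo = 1.
Proof.
apply: ps_ext => n; rewrite mulrBl mul1r ps_coefD.
rewrite -[ps_coef (- _) n]/(- ps_coef (psX * ps_geo) n) ps_coefXM /=.
by rewrite coef1; case: n => [|n] /=; rewrite ?subr0 ?subrr.
Qed.

(** * Symmetric unimodal polynomials and Eulerian polynomials *)

(** The number [d] is twice the centre of symmetry and only bounds the degree: outer coefficients
    may vanish, so the condition is stable under sums with a common [d]. *)
Definition sym_unimodal (d : nat) (p : {poly rat}) : Prop :=
  [/\ forall j, (d < j)%N -> p`_j = 0,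
      forall j, (j <= d)%N -> p`_j = p`_(d - j),
      0 <= p`_0
    & forall i j, (i <= j)%N -> (j.*2 <= d)%N -> p`_i <= p`_j].

Lemma sym_unimodal0 d : sym_unimodal d 0.
Proof. by split=> [j|j||i j]; rewrite ?coef0. Qed.

Lemma sym_unimodal1 : sym_unimodal 0 1.
Proof.
split=> [j|j||i j]; rewrite ?coef1 //.
- by case: j.
- by rewrite leqn0 => /eqP ->.
- by move=> ij; case: j ij => // ij _; move: ij; rewrite leqn0 => /eqP ->.
Qed.

Lemma sym_unimodalD d p q :
  sym_unimodal d p -> sym_unimodal d q -> sym_unimodal d (p + q).
Proof.
move=> [p0 ps p1 pu] [q0 qs q1 qu]; split=> [j dj|j jd||i j ij jd]; rewrite !coefD.
- by rewrite p0 // q0 // addr0.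
- by rewrite ps // qs.
- by rewrite addr_ge0.
- by rewrite lerD // ?pu ?qu.
Qed.

Lemma sym_unimodalZ d c p : 0 <= c -> sym_unimodal d p -> sym_unimodal d (c *: p).
Proof.
move=> c0 [p0 ps p1 pu]; split=> [j dj|j jd||i j ij jd]; rewrite !coefZ.
- by rewrite p0 // mulr0.
- by rewrite ps.
- by rewrite mulr_ge0.
- by rewrite ler_wpM2l // pu.
Qed.

Lemma sym_unimodal_ge0 d p j : sym_unimodal d p -> 0 <= p`_j.
Proof.
move=> [p0 ps p1 pu].
have H k : (k.*2 <= d)%N -> 0 <= p`_k by move=> kd; rewrite (le_trans p1) // pu.
case: (leqP j d) => [jd|/p0 -> //].
case: (leqP j.*2 d) => [/H //|jd2]; rewrite ps // H //; lia.
Qed.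

(** The index [j] is at least as close to the centre [d / 2] as [i]; if it lies beyond the centre,
    reflect it. *)
Lemma sym_unimodal_ge0_near d p i j : sym_unimodal d p ->
  (i <= j)%N -> (i + j <= d)%N -> p`_i <= p`_j.
Proof.
move=> [p0 ps p1 pu] ij ijd.
case: (leqP j.*2 d) => [jd2|jd2]; first exact: pu.
by rewrite (ps j); [apply: pu|]; lia.
Qed.

Lemma sym_unimodalMX d p : sym_unimodal d p -> sym_unimodal d.+2 ('X * p).
Proof.
move=> Hp; have p0' := sym_unimodal_ge0 _ Hp; case: (Hp) => p0 ps p1 pu.
split=> [j|j||i j]; rewrite ?coefXM ?eqxx //.
- by case: j => //= j dj; rewrite p0 //; lia.
- case: j => /= [_|j jd]; first by rewrite p0.
  have [->|jd'] := eqVneq j d.+1; first by rewrite subnn p0.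
  have -> : (d.+2 - j.+1 = (d - j).+1)%N by lia.
  by rewrite /= ps //; lia.
- by case: i j => [|i] [|j] //= ij jd; rewrite pu // -ltnS; lia.
Qed.

(** These all-ones polynomials, shifted to a common centre, generate the symmetric unimodal ones by
    nonnegative combinations. *)
Definition run_poly d : {poly rat} := \poly_(i < d.+1) 1.

(** Compare coefficients in [(1 - z) (1 + ... + z^d) p = (1 - z^(d+1)) p]. *)
Lemma coef_run_polyM d p j :
  (run_poly d * p)`_j.+1 = (run_poly d * p)`_j + p`_j.+1 - (if (d <= j)%N then p`_(j - d) else 0).
Proof.
have E : (1 - 'X) * run_poly d = 1 - 'X^(d.+1).
  rewrite -opprB mulNr -[RHS]opprB subrX1 /run_poly poly_def; congr (- (_ * _)).
  by apply: eq_bigr => i _; rewrite scale1r.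
have := congr1 (fun q : {poly rat} => (q * p)`_j.+1) E.
rewrite -mulrA mulrBl mul1r coefB coefXM /= mulrBl mul1r coefB coefXnM ltnS subSS.
by rewrite ltnNge; case: (d <= j)%N => /= ?; lra.
Qed.

Lemma run_polyM_sym d e p : sym_unimodal e p -> sym_unimodal (d + e) (run_poly d * p).
Proof.
move=> Hp; have p0' := sym_unimodal_ge0 _ Hp; case: (Hp) => p0 ps p1 pu.
have cM j : (run_poly d * p)`_j = \sum_(i < d.+1) (if (i <= j)%N then p`_(j - i) else 0).
  rewrite /run_poly poly_def mulr_suml coef_sum; apply: eq_bigr => i _.
  by rewrite scale1r coefXnM ltnNge; case: (i <= j)%N.
split=> [j dj|j jd||i j ij].
- rewrite cM big1 // => i _; case: ifP => // ij; rewrite p0 //.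
  by have := ltn_ord i; lia.
- rewrite !cM (reindex_inj rev_ord_inj) /=; apply: eq_bigr => i _.
  have iD := ltn_ord i; case: ifP => h1; case: ifP => h2 //.
  + case: (leqP (j - (d.+1 - i.+1)) e) => [H|H]; first by rewrite ps //; congr (p`__); lia.
    by exfalso; lia.
  + by rewrite p0 //; lia.
  + by rewrite p0 //; lia.
- by rewrite cM sumr_ge0 // => i _; case: ifP.
- elim: j ij => [|j IHj]; first by rewrite leqn0 => /eqP ->.
  rewrite leq_eqVlt => /predU1P [-> //|ij jd].
  apply: le_trans (IHj ij _) _; first by lia.
  (* The increment is [p_(j+1) - p_(j-d)], and [j + 1] is at least as close to the centre
     [e / 2]. *)
  rewrite coef_run_polyM -addrA lerDl subr_ge0.
  by case: ifP => // dj; apply: (sym_unimodal_ge0_near Hp); lia.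
Qed.

(** Subtracting the constant coefficient times a full run clears both end coefficients; the rest is
    divisible by [z] and has the same centre. *)
Lemma sym_unimodal_peel d p : sym_unimodal d.+2 p ->
  exists2 q, sym_unimodal d q & p = p`_0 *: run_poly d.+2 + 'X * q.
Proof.
move=> Hp; have p0' := sym_unimodal_ge0 _ Hp; case: (Hp) => p0 ps p1 pu.
pose q : {poly rat} := \poly_(i < d.+1) (p`_i.+1 - p`_0).
have qE i : (i <= d)%N -> q`_i = p`_i.+1 - p`_0 by rewrite coef_poly ltnS => ->.
exists q.
  split=> [j dj|j jd||i j ij jd].
  - by rewrite coef_poly ltnNge dj.
  - by rewrite !qE ?leq_subr // ps; [congr (p`__ - _)|]; lia.
  - by rewrite qE // subr_ge0; apply: (sym_unimodal_ge0_near Hp); lia.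
  - by rewrite !qE ?lerD2r ?pu //; lia.
apply/polyP => j; rewrite coefD coefZ coefXM coef_poly.
case: j => [|j] /=; first by rewrite addr0 mulr1.
rewrite !ltnS; case: (leqP j d) => [jd|dj].
  by rewrite qE // (leq_trans jd) // mulr1 addrC subrK.
rewrite [q`_j]coef_poly (ltnNge j) dj /= addr0.
case: (leqP j d.+1) => [jd|dj']; last by rewrite p0 // mulr0.
by rewrite mulr1 ps; [congr (p`__)|]; lia.
Qed.

(** Peel runs off [p] one at a time, by induction on [d]; multiplying by a run preserves the
    property. *)
Lemma sym_unimodalM d e p q :
  sym_unimodal d p -> sym_unimodal e q -> sym_unimodal (d + e) (p * q).
Proof.
have [k] := ubnP d; elim: k d p => // k IHk d p dk Hp Hq.
have p0 := sym_unimodal_ge0 0 Hp.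
have base : p = p`_0 *: run_poly d -> sym_unimodal (d + e) (p * q).
  by move=> ->; rewrite -scalerAl; apply/sym_unimodalZ/run_polyM_sym.
case: d => [|[|d]] in dk Hp base *.
- apply: base; apply/polyP => j; rewrite coefZ coef_poly.
  by case: Hp => H _ _ _; case: j => [|j]; rewrite ?mulr1 //= mulr0 H.
- apply: base; apply/polyP => j; rewrite coefZ coef_poly.
  case: Hp => H0 Hs _ _; case: j => [|[|j]]; rewrite ?mulr1 //=.
    by rewrite (Hs 0).
  by rewrite mulr0 H0.
have [r Hr ->] := sym_unimodal_peel Hp.
rewrite mulrDl -scalerAl; apply: sym_unimodalD.
  by apply: sym_unimodalZ => //; apply: run_polyM_sym.
rewrite -mulrA !addSn; apply: sym_unimodalMX; apply: IHk => //; lia.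
Qed.

(** With [A_b] for [eulerian b], the quotient [A_b / (1 - z)^(b+1)] is the series of [(n+1)^b z^n];
    so [A_b] has degree [b - 1] for [b > 0], without the extra factor [z] of some conventions. *)
Fixpoint eulerian (b : nat) : {poly rat} :=
  if b is b'.+1 then
    (1 + b'%:R *: 'X) * eulerian b' + ('X - 'X^2) * (eulerian b')^`()
  else 1.

(** The triangular recurrence of the Eulerian numbers. *)
Lemma eulerian_coef b j : (eulerian b.+1)`_j =
  j.+1%:R * (eulerian b)`_j +
  (if j is k.+1 then (b%:R - k%:R) * (eulerian b)`_k else 0).
Proof.
rewrite /= mulrDl mul1r !mulrBl -scalerAl expr2 -mulrA !coefD coefZ coefN !coefXM.
case: j => [|[|j]] /=; rewrite ?coef_deriv; set A := eulerian b.
- by rewrite mulr0 subr0 !addr0 mul1r.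
- by rewrite -[A`_1 *+ 1]/(A`_1) subr0; ring.
- rewrite -[A`__ *+ j.+2]mulr_natl -[A`__ *+ j.+1]mulr_natl -!(natr1 j.+2) -!(natr1 j.+1).
  by ring.
Qed.

(** Reflection exchanges the two weights of the triangular recurrence, and up to the middle the
    increments of the new row are nonnegative combinations of entries and increments of the old
    one. *)
Lemma sym_unimodal_eulerian b : sym_unimodal b (eulerian b.+1).
Proof.
elim: b => [|b IHb].
  rewrite /= scale0r addr0 mul1r derivC mulr0 addr0; exact: sym_unimodal1.
move: (IHb) (fun j => sym_unimodal_ge0 j IHb) => [].
set A := eulerian b.+1 => A0 As A1 Au Age.
have cA := eulerian_coef b.+1; rewrite -/A in cA.
have stepA j : (j.*2 <= b.+1)%N -> (if j is k.+1 then A`_k else 0) <= A`_j.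
  case: j => [//|j] jb; apply: (sym_unimodal_ge0_near IHb); lia.
split=> [j bj|j jb||i j ij jb]; first 1 last.
- rewrite !cA; case: j jb => [_|j jb].
    by rewrite subn0 (A0 b.+1) // mulr0 add0r addr0 (As 0) // subn0 -natr1; ring.
  rewrite subSS; case E : (b - j)%N => [|k].
    have -> : j = b by lia.
    by rewrite (A0 b.+1) // (As b) // subnn -natr1 addr0; ring.
  rewrite (As j.+1) ?(As j); [|lia..].
  have -> : (b - j.+1 = k)%N by lia.
  rewrite E addrC; congr (_ * _ + _ * _).
    by rewrite -natrB; [congr (_%:R)|]; lia.
  by rewrite -natrB; [congr (_%:R)|]; lia.
- by rewrite cA addr0 mul1r.
- elim: j ij jb => [|j IHj]; first by rewrite leqn0 => /eqP ->.
  rewrite leq_eqVlt => /predU1P [-> //|ij jb].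
  apply: le_trans (IHj ij _) _; first by lia.
  have d1 := stepA j.+1 ltac:(lia); have d2 := stepA j ltac:(lia).
  have jb' : (j%:R <= b%:R :> rat) by rewrite ler_nat; lia.
  rewrite !cA -subr_ge0.
  case: j ij jb {IHj} d1 d2 jb' => [|j] _ _ d1 d2 jb'.
    rewrite -[1%:R]/1 -natr1; have := Age 0; nra.
  rewrite -!natr1 in jb' *.
  have -> : (j%:R + 1 + 1 + 1) * A`_j.+2 + (b%:R + 1 - (j%:R + 1)) * A`_j.+1 -
     ((j%:R + 1 + 1) * A`_j.+1 + (b%:R + 1 - j%:R) * A`_j) =
     (j%:R + 3) * (A`_j.+2 - A`_j.+1) + (b%:R - j%:R + 1) * (A`_j.+1 - A`_j) by ring.
  have j0 := ler0n rat j.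
  by apply: addr_ge0; apply: mulr_ge0; lra.
- rewrite cA; case: j bj => // j bj; rewrite (A0 j.+1) ?mulr0 ?add0r; last by lia.
  have [->|jb] := eqVneq j b.+1; first by rewrite subrr mul0r.
  by rewrite A0 ?mulr0 //; lia.
Qed.

(** The Euler operator [z d/dz]. *)
Definition ps_theta f := PS (fun n => n%:R * ps_coef f n).

Lemma ps_thetaM f g : ps_theta (f * g) = ps_theta f * g + f * ps_theta g.
Proof.
apply: ps_ext => n; rewrite ps_coefD /= /ps_mul mulr_sumr -big_split /=.
apply: eq_bigr => i _; rewrite mulrCA.
have -> : n%:R = i%:R + (n - i)%:R :> rat by rewrite -natrD subnKC // -ltnS.
by move: (n - i)%N => k; rewrite mulrDl mulrDr mulrCA mulrA.
Qed.

Lemma ps_theta_poly p : ps_theta (ps_poly p) = ps_poly ('X * p^`()).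
Proof.
apply: ps_ext => n /=; rewrite coefXM coef_deriv.
by case: n => [|n] /=; rewrite ?mul0r // mulr_natl.
Qed.

(** The additional factor [1 - z] avoids the exponent [k - 1]. *)
Lemma ps_theta_expr k : ps_theta ((1 - psX) ^+ k) * (1 - psX) =
  - k%:R * psX * (1 - psX) ^+ k.
Proof.
have E : 1 - psX = ps_poly (1 - 'X) by rewrite rmorphB rmorph1.
rewrite E -!rmorphXn /= ps_theta_poly -!rmorphM -(rmorph_nat ps_poly) -rmorphN -!rmorphM /=.
congr ps_poly; case: k => [|k]; first by rewrite expr0 derivC !mulr0 mul0r oppr0 !mul0r.
rewrite deriv_exp derivB derivC derivX exprS -mulr_natl /=; ring.
Qed.

Definition ps_pow b := PS (fun n => n.+1%:R ^+ b).

Lemma ps_powS b : ps_pow b.+1 = ps_pow b + ps_theta (ps_pow b).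
Proof. by apply: ps_ext => n; rewrite ps_coefD /= exprS -natr1; ring. Qed.

(** Apply [z d/dz] to the identity for [b]; if [f] is the series for [b], the one for [b + 1] is
    [f + z f']. *)
Lemma eulerian_ps_pow b : (1 - psX) ^+ b.+1 * ps_pow b = ps_poly (eulerian b).
Proof.
elim: b => [|b IHb].
  have -> : ps_pow 0 = ps_geo by exact: ps_ext.
  by rewrite expr1 ps_geoK rmorph1.
have := congr1 ps_theta IHb; rewrite ps_thetaM ps_theta_poly => H.
rewrite ps_powS exprS mulrDr.
have -> : (1 - psX) * (1 - psX) ^+ b.+1 * ps_pow b = (1 - psX) * ps_poly (eulerian b).
  by rewrite -mulrA IHb.
have -> : (1 - psX) * (1 - psX) ^+ b.+1 * ps_theta (ps_pow b) =
  (1 - psX) * ps_poly ('X * (eulerian b)^`()) + b.+1%:R * psX * ps_poly (eulerian b).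
  rewrite -H mulrDr [(1 - psX) * (_ * ps_pow b)]mulrA (mulrC (1 - psX) (ps_theta _)).
  rewrite ps_theta_expr -IHb; ring.
have -> : 1 - psX = ps_poly (1 - 'X) by rewrite rmorphB rmorph1.
rewrite -(rmorph_nat ps_poly) -!rmorphM -!rmorphD /=.
by congr ps_poly; rewrite -mul_polyC -natr1; rewrite polyC_natr; ring.
Qed.

(** The coefficient of [z^n] counts the ways to spread [b] elements over [n + 1] steps with the
    first step used. *)
Definition ps_dpow b := PS (fun n => n.+1%:R ^+ b - n%:R ^+ b).

Lemma eulerian_ps_dpow b : (1 - psX) ^+ b.+1 * ps_dpow b.+1 = ps_poly (eulerian b.+1).
Proof.
rewrite -eulerian_ps_pow [in RHS]exprSr -mulrA; congr (_ * _).
apply: ps_ext => n; rewrite mulrBl mul1r ps_coefD.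
rewrite -[ps_coef (- _) n]/(- ps_coef (psX * ps_pow b.+1) n) ps_coefXM /=.
by case: n => [|n] //; rewrite expr0n.
Qed.

(** * Walks in families of subsets *)

(** The difference of [X^(n+1)] is [(n+1) X^n] plus lower powers, whose antidifferences are known by
    induction. *)
Lemma poly_antidiff (p : {poly rat}) : exists q, q \Po ('X + 1) - q = p.
Proof.
pose D (q : {poly rat}) := q \Po ('X + 1) - q.
have DD q r : D (q + r) = D q + D r by rewrite /D comp_polyD opprD addrACA.
have DZ c q : D (c *: q) = c *: D q by rewrite /D comp_polyZ scalerBr.
have Dsum n (c : nat -> rat) (f : nat -> {poly rat}) :
    (forall i, (i < n)%N -> exists q, D q = f i) ->
    exists q, D q = \sum_(i < n) c i *: f i.
  elim: n => [_|n IHn H]; first by exists 0; rewrite /D comp_poly0 subrr big_ord0.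
  have [|q Eq] := IHn; first by move=> i ni; apply: H; rewrite ltnS ltnW.
  have [r Er] := H n (ltnSn n).
  by exists (q + c n *: r); rewrite DD DZ Eq Er big_ord_recr.
have DX n : exists q, D q = 'X^n.
  have [k] := ubnP n; elim: k n => // k IHk n nk.
  have [q Eq] := Dsum n (fun i => 'C(n.+1, i)%:R) (fun i => 'X^i) (fun i ni => IHk i ltac:(lia)).
  exists (n.+1%:R^-1 *: ('X^(n.+1) - q)).
  have E : 'X^(n.+1) \Po ('X + 1) =
      \sum_(i < n) 'C(n.+1, i)%:R *: 'X^i + n.+1%:R *: 'X^n + 'X^(n.+1) :> {poly rat}.
    rewrite comp_Xn_poly addrC exprDn !big_ord_recr /=.
    rewrite !expr1n !mul1r binn mulr1n binSn scaler_nat; congr (_ + _ + _).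
    by apply: eq_bigr => i _; rewrite expr1n mul1r scaler_nat.
  rewrite DZ -scaleN1r DD DZ Eq {1}/D E scaleN1r addrK addrAC subrr add0r.
  by rewrite scalerA mulVf ?scale1r // pnatr_eq0.
have [q Eq] := Dsum (size p) (fun i => p`_i) (fun i => 'X^i) (fun i _ => DX i).
by exists q; rewrite -/(D q) Eq -poly_def coefK.
Qed.

Definition polyfun (f : int -> rat) :=
  exists p : {poly rat}, forall t : int, f t = p.[t%:~R].

Lemma polyfunD f g : polyfun f -> polyfun g -> polyfun (fun t => f t + g t).
Proof. by move=> [p Ep] [q Eq]; exists (p + q) => t; rewrite hornerD Ep Eq. Qed.

Lemma polyfun_sum (I : Type) (r : seq I) (P : pred I) (F : I -> int -> rat) :
  (forall i, P i -> polyfun (F i)) -> polyfun (fun t => \sum_(i <- r | P i) F i t).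
Proof.
move=> H; elim: r => [|i r [p Ep]].
  by exists 0 => t; rewrite big_nil horner0.
case Pi: (P i); last by exists p => t; rewrite big_cons Pi.
have [q Eq] := H i Pi.
by exists (q + p) => t; rewrite big_cons Pi hornerD Ep Eq.
Qed.

(** Subtracting a polynomial antidifference leaves a function of period 1 on the integers, hence a
    constant. *)
Lemma polyfun_antidiff f : polyfun (fun t => f (t + 1) - f t) -> polyfun f.
Proof.
move=> [p Ep]; have [q Eq] := poly_antidiff p.
exists (q + (f 0 - q.[0])%:P) => t; rewrite hornerD hornerC.
have H z : f (z + 1) - q.[(z + 1)%:~R] = f z - q.[z%:~R].
  have := Ep z; rewrite -Eq !hornerE horner_comp !hornerE.
  by rewrite intrD; lra.
suff : f t - q.[t%:~R] = f 0 - q.[0] by lra.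
elim/int_ind: t => [//|n <-|n <-].
  by rewrite -[n.+1]addn1 PoszD H.
by rewrite -(H (- n.+1%:Z)) -[n.+1]addn1 PoszD opprD addrNK.
Qed.

Section SubsetWalks.
Import mathcomp.boot.fintype mathcomp.boot.finset.
Variables (Y : finType) (ty : Y -> bool) (ideal : {pred {set Y}}).

Definition tyset (b : bool) : {set Y} := [set y | ty y == b].

Definition step (b : bool) (S' S : {set Y}) :=
  [&& S' \in ideal, S' \subset S & S :\: S' \subset tyset b].

Definition step_sum b (t : rat) (phi : {set Y} -> rat) (S : {set Y}) : rat :=
  \sum_(S' | step b S' S) t ^+ #|S :\: S'| * phi S'.

(** On ideals this counts the walks of [j] steps from the empty set, with types alternating from
    [false] on; trivial steps are allowed. *)
Fixpoint walk (j : nat) : {set Y} -> rat :=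
  if j is j'.+1 then step_sum (odd j') 1 (walk j') else fun S => (S == set0)%:R.

(* The extension to negative times for which [walkzS] holds: inverting a step
   amounts to conjugating it by the sign [(-1) ^+ #|S|]. *)
Definition walkz (z : int) (S : {set Y}) : rat :=
  match z with Posz n => walk n S | Negz n => (-1) ^+ #|S| * walk n S end.

(** Expand the product of [s + t] over [S :\: U]: each element independently lies in [T] or not. *)
Lemma sum_interval_expr (U S : {set Y}) (s t : rat) : U \subset S ->
  \sum_(T : {set Y} | (U \subset T) && (T \subset S)) s ^+ #|S :\: T| * t ^+ #|T :\: U| =
  (s + t) ^+ #|S :\: U|.
Proof.
move=> US.
(* [F] is the factor of an element of [T], [G] that of an element outside; the zeros force [U] into
   [T] and [T] into [S]. *)
pose F y : rat := if y \in U then 1 else if y \in S then t else 0.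
pose G y : rat := if y \in U then 0 else if y \in S then s else 1.
have <- : \prod_y (F y + G y) = (s + t) ^+ #|S :\: U|.
  rewrite -prodr_const [RHS]big_mkcond; apply: eq_bigr => y _.
  rewrite /F /G inE; case: (y \in U); first by rewrite addr0.
  by case: (y \in S); rewrite ?add0r //= addrC.
rewrite bigA_distr big_mkcond; apply: eq_bigr => T _.
case: ifP => [/andP [UT TS]|/negbT H].
  rewrite -!prodr_const !(big_mkcond (fun y => y \in _ :\: _)) -big_split /=.
  apply: eq_bigr => y _; rewrite /F /G !inE.
  have := subsetP UT y; have := subsetP TS y.
  case: (y \in U) => [_ /(_ isT) ->|]; first by rewrite mulr1.
  case: (y \in T) => [/(_ isT) -> _|_ _]; first by rewrite mul1r.
  by rewrite mulr1.
apply/esym; move: H; rewrite negb_and => /orP [] /subsetPn [y yU yT].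
  by rewrite (bigD1 y) //= (negPf yT) /G yU mul0r.
rewrite (bigD1 y) //= yU /F (negPf yT).
by rewrite (negPf (contra (subsetP US y) yT)) mul0r.
Qed.

Lemma eq_step_sum b t f g S : {in ideal, f =1 g} ->
  step_sum b t f S = step_sum b t g S.
Proof. by move=> fg; apply: eq_bigr => S' /and3P [/fg -> _ _]. Qed.

Lemma step_refl b S : S \in ideal -> step b S S.
Proof. by move=> SI; rewrite /step SI subxx setDv sub0set. Qed.

Lemma step_card b S' S : step b S' S -> S' != S -> (#|S'| < #|S|)%N.
Proof.
by case/and3P=> _ S'S _ neq; apply: proper_card; rewrite properEneq neq.
Qed.

(** Since [0^0 = 1], exactly the trivial step survives. *)
Lemma step_sum0 b f S : S \in ideal -> step_sum b 0 f S = f S.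
Proof.
move=> SI; rewrite /step_sum (bigD1 S) ?step_refl //= setDv cards0 expr0 mul1r.
rewrite big1 ?addr0 // => S' /andP [/and3P [_ S'S _] neq].
rewrite expr0n cards_eq0 setD_eq0; case: (boolP (S \subset S')) => SS'; rewrite ?mul0r //.
by move: neq; rewrite eqEsubset S'S SS'.
Qed.

Hypothesis ideal_between : forall b (U T S : {set Y}), U \in ideal -> S \in ideal ->
  U \subset T -> T \subset S -> S :\: U \subset tyset b -> T \in ideal.

(** Every set between [U] and [S] is an ideal by [ideal_between], so summing over the middle set
    gives [(s + t)^k] for the [k] elements added in all. *)
Lemma step_sum_comp b s t f S : S \in ideal ->
  step_sum b s (step_sum b t f) S = step_sum b (s + t) f S.
Proof.
move=> SI; rewrite /step_sum.
under eq_bigr => T _ do rewrite big_distrr /=.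
rewrite (exchange_big_dep (fun U => step b U S)) /=; last first.
  move=> T U /and3P [TI TS ST] /and3P [UI UT TU].
  rewrite /step UI (fintype.subset_trans UT TS) /=; apply/fintype.subsetP => y.
  rewrite inE => /andP [yU yS]; case: (boolP (y \in T)) => yT.
    by apply: (fintype.subsetP TU); rewrite inE yU.
  by apply: (fintype.subsetP ST); rewrite inE yT.
apply: eq_bigr => U /and3P [UI US SU].
rewrite -sum_interval_expr // mulr_suml.
apply: eq_big => [T|T _]; last by rewrite mulrA.
apply/andP/andP => [[/and3P [_ TS _] /and3P [_ UT _]] //|[UT TS]].
split; apply/and3P; split=> //.
- exact: (ideal_between UI SI UT TS SU).
- by apply: fintype.subset_trans SU; apply: setDS.
- by apply: fintype.subset_trans SU; apply: setSD.
Qed.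

Hypothesis ideal0 : set0 \in ideal.
Hypothesis ideal_true : forall S, S \in ideal -> S \subset tyset true -> S = set0.

(** Nonnegative times hold by definition; at negative times, the inverse [E(-1)] of a step is its
    conjugate by signs. *)
Lemma walkzS z S : S \in ideal ->
  walkz (z + 1) S = step_sum (odd `|z|%N) 1 (walkz z) S.
Proof.
move=> SI; case: z => [n|[|n]].
- by rewrite -PoszD addn1.
(* From time -1 to time 0: only the empty set has weight at time -1, and by [ideal_true] a step of
   type [true] from it reaches no other ideal. *)
- rewrite -[Negz 0 + 1]/(Posz 0) /= /step_sum (bigID (pred1 set0)) /=.
  rewrite [X in _ = _ + X]big1 ?addr0; last first.
    by move=> S' /andP [_ /negPf ->]; rewrite !mulr0.
  case: eqVneq => [->|S0].
    rewrite (big_pred1 set0) ?eqxx ?cards0 ?expr0 ?expr1n ?mulr1 //.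
    by move=> S' /=; apply/andP/eqP => [[_ /eqP] //|->]; rewrite step_refl.
  rewrite big_pred0 // => S'; apply: contraNF S0 => /andP [/and3P [_ _ H] /eqP S'0].
  by rewrite (ideal_true SI) //; move: H; rewrite S'0 setD0.
- have -> : Negz n.+1 + 1 = Negz n by rewrite !NegzE -addn1 PoszD opprD addrK.
  (* Applying [E(-1)] of the same type undoes the last step of [walk n.+1]. *)
  have E : {in ideal, walk n =1 step_sum (odd n) (-1) (walk n.+1)}.
    by move=> T TI; rewrite /= step_sum_comp // addNr step_sum0.
  rewrite /= negbK E // /step_sum mulr_sumr; apply: eq_bigr => S' /and3P [_ S'S _].
  rewrite expr1n mul1r mulrA; congr (_ * _).
  rewrite -[#|S|](cardsID S') (setIidPr S'S) exprD -mulrA -exprD addnn.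
  by rewrite -mul2n exprM sqrrN !expr1n mulr1.
Qed.

Lemma walkz_opp n S : walkz (- n%:Z) S = (-1) ^+ #|S| * walkz (n%:Z - 1) S.
Proof.
case: n => [|n].
  by rewrite (_ : 0%:Z - 1 = Negz 0) //= mulrA -exprD addnn -mul2n exprM sqrrN !expr1n mul1r.
by rewrite -NegzE -[n.+1]addn1 PoszD addrK.
Qed.

Lemma step_sum1_recl b f S : S \in ideal ->
  step_sum b 1 f S = f S + \sum_(S' | step b S' S && (S' != S)) f S'.
Proof.
move=> SI; rewrite /step_sum (bigD1 S) ?step_refl //= expr1n mul1r.
by congr (_ + _); apply: eq_bigr => S' _; rewrite expr1n mul1r.
Qed.

(** Two consecutive steps change the value at [S] by a sum over proper sub-ideals, which is
    polynomial in [t] by induction on the cardinality; then take an antidifference. *)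
Lemma walkz_polyfun S (b : bool) : S \in ideal ->
  polyfun (fun t => walkz (t * 2 + b%:Z) S).
Proof.
have odd0 (t : int) : odd `|(t * 2 + 0%:Z)%R|%N = false by lia.
have odd1 (t : int) : odd `|(t * 2 + 1%:Z)%R|%N = true by lia.
have rec0 t T : T \in ideal -> walkz (t * 2 + 1%:Z) T = walkz (t * 2 + 0%:Z) T +
    \sum_(U | step false U T && (U != T)) walkz (t * 2 + 0%:Z) U.
  by move=> TI; rewrite -{1}[t * 2]addr0 walkzS // odd0 step_sum1_recl.
have rec1 t T : T \in ideal -> walkz ((t + 1) * 2 + 0%:Z) T = walkz (t * 2 + 1%:Z) T +
    \sum_(U | step true U T && (U != T)) walkz (t * 2 + 1%:Z) U.
  move=> TI; rewrite -step_sum1_recl // -(odd1 t) -walkzS //; congr walkz; lia.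
have [k] := ubnP #|S|; elim: k S b => // k IHk S b Sk SI.
have small b' (b'' : bool) T : step b' T S -> T != S -> polyfun (fun t => walkz (t * 2 + b''%:Z) T).
  move=> st neq; have := step_card st neq; case/and3P: st => TI _ _ ?.
  by apply: IHk => //; lia.
have pf0 : polyfun (fun t => walkz (t * 2 + 0%:Z) S).
  apply: polyfun_antidiff.
  have E t : walkz ((t + 1) * 2 + 0%:Z) S - walkz (t * 2 + 0%:Z) S =
      \sum_(U | step false U S && (U != S)) walkz (t * 2 + 0%:Z) U +
      \sum_(U | step true U S && (U != S)) walkz (t * 2 + 1%:Z) U.
    by rewrite rec1 // rec0 // addrAC [X in X + _]addrAC subrr add0r.
  under eq_fun do rewrite E.
  apply: polyfunD; apply: polyfun_sum => U /andP [st neq].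
    exact: (small _ false U st neq).
  exact: (small _ true U st neq).
case: b => //; under eq_fun do rewrite rec0 //.
apply: polyfunD => //; apply: polyfun_sum => U /andP [st neq].
exact: (small _ false U st neq).
Qed.

End SubsetWalks.

(** * Block decomposition of walks *)

Section BlockDecomposition.
Import mathcomp.boot.fintype mathcomp.boot.finset.
Variables (Y : finType) (ty : Y -> bool) (ideal : {pred {set Y}}).
Hypothesis ideal_between : forall b (U T S : {set Y}), U \in ideal -> S \in ideal ->
  U \subset T -> T \subset S -> S :\: U \subset tyset ty b -> T \in ideal.
Hypothesis ideal0 : set0 \in ideal.
Hypothesis ideal_true : forall S, S \in ideal -> S \subset tyset ty true -> S = set0.

Local Notation step := (step ty ideal).
Local Notation step_sum := (step_sum ty ideal).
Local Notation walk := (walk ty ideal).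

Lemma step_sum_sumr b t n (F : 'I_n -> {set Y} -> rat) S :
  step_sum b t (fun T => \sum_(i < n) F i T) S = \sum_(i < n) step_sum b t (F i) S.
Proof.
rewrite /step_sum exchange_big /=; apply: eq_bigr => T _.
by rewrite big_distrr.
Qed.

Lemma step_sumD b t f g S :
  step_sum b t (fun T => f T + g T) S = step_sum b t f S + step_sum b t g S.
Proof.
by rewrite /step_sum -big_split /=; apply: eq_bigr => T _; rewrite mulrDr.
Qed.

Lemma step_sumB b t f g S :
  step_sum b t (fun T => f T - g T) S = step_sum b t f S - step_sum b t g S.
Proof.
by rewrite /step_sum -sumrB; apply: eq_bigr => T _; rewrite mulrBr.
Qed.

(* Solves [(1 - z M) phi = (M - 1) psi] for [M] the operator of one step: the
   solution is [(M - 1) (1 - z M)^-1 psi], whose entries are Eulerian fractions. *)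
Lemma block_solve b (phi psi : {set Y} -> ps) :
  (forall S, S \in ideal -> ps_coef (phi S) 0 =
     step_sum b 1 (fun T => ps_coef (psi T) 0) S - ps_coef (psi S) 0) ->
  (forall S N, S \in ideal -> ps_coef (phi S) N.+1 =
     step_sum b 1 (fun T => ps_coef (phi T) N) S +
     (step_sum b 1 (fun T => ps_coef (psi T) N.+1) S - ps_coef (psi S) N.+1)) ->
  forall S, S \in ideal ->
    phi S = \sum_(S' | step b S' S) ps_dpow #|S :\: S'| * psi S'.
Proof.
move=> phi0 phiS S SI.
pose w N T := ps_coef (psi T) N.
(* The recursion is unrolled, with [M^j] being the step operator of parameter [j]. *)
have key N T : T \in ideal -> ps_coef (phi T) N =
    \sum_(j < N.+1) (step_sum b j.+1%:R (w (N - j)%N) T - step_sum b j%:R (w (N - j)%N) T).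
  elim: N T => [|N IHN] T TI.
    by rewrite big_ord1 phi0 // (step_sum0 ty).
  rewrite phiS // big_ord_recl /= subn0 (step_sum0 ty) // addrC; congr (_ + _).
  rewrite (eq_step_sum _ _ _ _ IHN) step_sum_sumr; apply: eq_bigr => j _.
  by rewrite step_sumB !(step_sum_comp ideal_between) // !nat1r /bump /= subSS.
apply: ps_ext => N; rewrite key // ps_coef_sum /=.
under eq_bigr do rewrite /step_sum -sumrB.
rewrite exchange_big /=; apply: eq_bigr => T _; apply: eq_bigr => j _.
by rewrite -mulrBl.
Qed.

(** For an ideal [S] the coefficient of index [N] counts the walks of length [2 N + 2] to [S] whose
    last nontrivial step has type [false]; [downset_series] is the analogue for type [true]. *)
Definition upset_series S := PS (fun N =>
  \sum_(i < N.+1) (walk i.*2.+1 S - walk i.*2 S)).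
Definition downset_series S := PS (fun N =>
  \sum_(i < N.+1) (walk i.*2.+2 S - walk i.*2.+1 S)).
Local Notation xs := upset_series.
Local Notation ys := downset_series.

(** This is the recurrence from time -1 to time 0; the sign at time -1 is trivial since only the
    empty set has weight. *)
Lemma walk0_step_true S : S \in ideal -> step_sum true 1 (walk 0) S = walk 0 S.
Proof.
move=> SI; have := walkzS ideal_between ideal0 ideal_true (-1) SI.
rewrite /= => ->; apply: eq_step_sum => T _ /=.
by case: eqVneq => [->|_]; rewrite ?cards0 ?mul1r ?mulr0.
Qed.

Lemma walk_even_series S N :
  walk N.*2.+2 S = walk 0 S + ps_coef (xs S) N + ps_coef (ys S) N.
Proof.
rewrite -addrA -big_split /=.
elim: N => [|N IHN]; first by rewrite big_ord1 /=; ring.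
by rewrite big_ord_recr /= addrA -IHN /=; ring.
Qed.

Lemma walk_odd_series S N :
  walk N.+1.*2.+1 S = walk 0 S + ps_coef (xs S) N.+1 + ps_coef (ys S) N.
Proof.
have := walk_even_series S N; have : ps_coef (xs S) N.+1 = ps_coef (xs S) N +
  (walk N.+1.*2.+1 S - walk N.+1.*2 S) by rewrite /= big_ord_recr.
rewrite -doubleS; lra.
Qed.

(** Call a step of type [false] and the next one of type [true] a round. The last block of type
    [false] starts either from the empty set after any number of trivial rounds (the factor
    [1 / (1 - z)]), or after a block of type [true] that ended in an earlier round (the factor
    [z]). *)
Lemma upset_series_rec S : S \in ideal -> xs S =
  \sum_(S' | step false S' S) ps_dpow #|S :\: S'| *
    ((S' == set0)%:R * ps_geo + psX * ys S').
Proof.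
have c N S' : ps_coef ((S' == set0)%:R * ps_geo + psX * ys S') N =
    walk 0 S' + (if N is k.+1 then ps_coef (ys S') k else 0).
  rewrite ps_coefD ps_coefXM; congr (_ + _); rewrite [walk 0 S']/=.
  by case: (S' == set0); [rewrite mul1r|rewrite mul0r].
apply: block_solve => [T TI|T N TI].
  have -> : ps_coef (xs T) 0 = step_sum false 1 (walk 0) T - walk 0 T.
    by rewrite /= big_ord1.
  by rewrite c addr0; congr (_ - _); apply: eq_step_sum => U _; rewrite c addr0.
rewrite c.
have E : walk N.+1.*2.+1 T = step_sum false 1 (walk N.+1.*2) T.
  by rewrite /= odd_double.
have : ps_coef (xs T) N.+1 = walk N.+1.*2.+1 T - walk 0 T - ps_coef (ys T) N.
  by rewrite walk_odd_series; ring.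
rewrite E doubleS => ->.
rewrite (eq_step_sum _ _ _ _ (g := fun U => ps_coef (xs U) N + (walk 0 U + ps_coef (ys U) N))).
  rewrite step_sumD (eq_step_sum _ _ _ _ (f := fun U => ps_coef (_ + _) _)
    (g := fun U => walk 0 U + ps_coef (ys U) N)); first by rewrite opprD !addrA.
  by move=> U _; rewrite c.
by move=> U _; rewrite walk_even_series; ring.
Qed.

(** The step of type [true] comes second in each round, so there is no factor [z]; no walk begins
    with a block of type [true]. *)
Lemma downset_series_rec S : S \in ideal -> ys S =
  \sum_(S' | step true S' S) ps_dpow #|S :\: S'| * xs S'.
Proof.
have E N T : walk N.*2.+2 T = step_sum true 1 (walk N.*2.+1) T.
  by rewrite /= odd_double.
apply: block_solve => [T TI|T N TI].
  have H U : walk 1 U = walk 0 U + ps_coef (xs U) 0 by rewrite /= big_ord1 /=; ring.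
  have -> : ps_coef (ys T) 0 = step_sum true 1 (walk 1) T - walk 1 T.
    by rewrite -(E 0) [LHS]big_ord1.
  rewrite (eq_step_sum _ _ _ _ (fun U _ => H U)) step_sumD walk0_step_true // H; ring.
have : ps_coef (ys T) N.+1 = walk N.+1.*2.+2 T - walk 0 T - ps_coef (xs T) N.+1.
  by rewrite walk_even_series; ring.
rewrite E => ->.
rewrite (eq_step_sum _ _ _ _ (g := fun U => walk 0 U + (ps_coef (ys U) N + ps_coef (xs U) N.+1))).
  by rewrite !step_sumD walk0_step_true //; ring.
by move=> U _; rewrite walk_odd_series; ring.
Qed.

(** Induction over the last block. A block of [c] elements contributes an Eulerian polynomial of
    degree [c - 1], so it loses 1 in [d] against its size; the factor [z] after each pair of blocks
    restores 2. Hence all summands share one centre. *)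
Lemma block_series_sym_unimodal S : S \in ideal ->
  (exists2 p, (1 - psX) ^+ #|S|.+1 * xs S = ps_poly p & sym_unimodal #|S|.-1 p) /\
  (exists2 p, (1 - psX) ^+ #|S|.+1 * (psX * ys S) = ps_poly p & sym_unimodal #|S| p).
Proof.
have [k] := ubnP #|S|; elim: k S => // k IHk S Sk SI.
pose good n d (f : ps) := exists2 p, (1 - psX) ^+ n * f = ps_poly p & sym_unimodal d p.
have good_sum n d (P : pred {set Y}) (F : {set Y} -> ps) :
    (forall T, P T -> good n d (F T)) -> good n d (\sum_(T | P T) F T).
  move=> H; elim/big_ind: _ => //.
    by exists 0; rewrite ?mulr0 ?rmorph0 //; apply: sym_unimodal0.
  move=> f g [p Ep Hp] [q Eq Hq]; exists (p + q); last exact: sym_unimodalD.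
  by rewrite mulrDr Ep Eq rmorphD.
have dpow0 : ps_dpow 0 = 0 by apply: ps_ext => n; rewrite /= subrr.
have term b (phi : {set Y} -> ps) d (T : {set Y}) : step b T S ->
    (T != S -> good #|T|.+1 d (phi T)) ->
    good #|S|.+1 (d + (#|S| - #|T|).-1) (ps_dpow #|S :\: T| * phi T).
  move=> st H; have [TS|TS] := eqVneq T S.
    rewrite TS setDv cards0 dpow0 mul0r.
    by exists 0; rewrite ?mulr0 ?rmorph0 //; apply: sym_unimodal0.
  have [p Ep Hp] := H TS; have lt := step_card st TS.
  have [_ TsubS _] := and3P st; rewrite cardsD (setIidPr TsubS).
  case E : (#|S| - #|T|)%N => [|c]; first by lia.
  exists (p * eulerian c.+1); last by apply: sym_unimodalM => //; apply: sym_unimodal_eulerian.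
  rewrite rmorphM /= -Ep -eulerian_ps_dpow.
  have -> : (#|S|.+1 = #|T|.+1 + c.+1)%N by lia.
  by rewrite exprD; ring.
have geoP T : T \in ideal -> (#|T| < k)%N ->
    good #|T|.+1 #|T| ((T == set0)%:R * ps_geo + psX * ys T).
  move=> TI Tk; have [_ [q Eq Hq]] := IHk T Tk TI.
  have [T0|T0] := eqVneq T set0; last first.
    by exists q => //; rewrite mul0r add0r.
  rewrite T0 cards0 in Eq Hq *; exists (1 + q); last first.
    by apply: sym_unimodalD => //; apply: sym_unimodal1.
  by rewrite mul1r mulrDr Eq expr1 ps_geoK rmorphD rmorph1.
split.
  rewrite upset_series_rec //; apply: good_sum => T st.
  have [->|TS] := eqVneq T S.
    rewrite setDv cards0 dpow0 mul0r.
    by exists 0; rewrite ?mulr0 ?rmorph0 //; apply: sym_unimodal0.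
  have lt := step_card st TS; have [TI _ _] := and3P st.
  have -> : (#|S|.-1 = #|T| + (#|S| - #|T|).-1)%N by lia.
  by apply: (term false (fun U => (U == set0)%:R * ps_geo + psX * ys U)) => // _; apply: geoP => //; lia.
rewrite downset_series_rec // mulr_sumr; apply: good_sum => T st.
have [->|TS] := eqVneq T S.
  rewrite setDv cards0 dpow0 mul0r mulr0.
  by exists 0; rewrite ?mulr0 ?rmorph0 //; apply: sym_unimodal0.
have lt := step_card st TS; have [TI _ _] := and3P st.
have [|[p Ep Hp] _] := IHk T _ TI; first by lia.
(* For empty [T] the truncated [#|T|.-1] would spoil the degree count, but then the series of [T] is
   zero. *)
case: (posnP #|T|) => T0.
  have x0 : xs T = 0.
    rewrite upset_series_rec // big1 // => U stU; have [->|UT] := eqVneq U T.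
      by rewrite setDv cards0 dpow0 mul0r.
    by have := step_card stU UT; rewrite T0.
  by exists 0; rewrite ?x0 ?mulr0 ?rmorph0 //; apply: sym_unimodal0.
have [q Eq Hq] : good #|S|.+1 (#|T|.-1 + (#|S| - #|T|).-1) (ps_dpow #|S :\: T| * xs T).
  by apply: (term true) => // _; exists p.
exists ('X * q); first by rewrite rmorphM mulrCA Eq.
have -> : #|S| = (#|T|.-1 + (#|S| - #|T|).-1).+2 by lia.
exact: sym_unimodalMX.
Qed.

(* The hypothesis says that no step of type [false] ends in [S], so that a
   walk to [S] has its last nontrivial step of type [true] *)
Lemma walk_series_sym_unimodal S : S \in ideal -> S != set0 ->
  (forall T, step false T S -> T = S) ->
  exists2 p, (1 - psX) ^+ #|S|.+1 * PS (fun N => walk N.*2 S) = ps_poly p &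
    sym_unimodal #|S| p.
Proof.
move=> SI S0 Sfalse; have [_ [p Ep Hp]] := block_series_sym_unimodal SI.
exists p => //; rewrite -Ep; congr (_ * _).
apply: ps_ext => N; rewrite ps_coefXM /=.
case: N => [|N]; first by rewrite /= (negPf S0).
rewrite doubleS walk_even_series /= (negPf S0) big1 ?addr0 ?add0r // => i _.
rewrite odd_double step_sum1_recl // big_pred0 ?addr0 ?subrr // => T.
by apply/negP => /andP [/Sfalse -> /eqP].
Qed.

End BlockDecomposition.

(** * Walks encoded by the times at which elements are added *)

Section WalkCount.
Import mathcomp.boot.fintype mathcomp.boot.finset.
Variables (Y : finType) (ty : Y -> bool) (ideal : {pred {set Y}}) (K : nat).

(* [f y] is the time at which a walk ending in [S] after [N] steps adds [y];
   elements outside of [S] have the dummy time [K]. *)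
Definition walk_times N (S : {set Y}) (f : {ffun Y -> 'I_K.+1}) :=
  [forall y, if y \in S then (f y < N)%N && (odd (f y) == ty y) else f y == K :> nat] &&
  [forall j : 'I_K.+1, (j <= N)%N ==> ([set y | (f y < j)%N] \in ideal)].

Lemma walk_timesP N (S : {set Y}) (f : {ffun Y -> 'I_K.+1}) : (N <= K)%N -> reflect
  [/\ forall y, y \in S -> (f y < N)%N /\ odd (f y) = ty y,
      forall y, y \notin S -> f y = K :> nat
    & forall j, (j <= N)%N -> [set y | (f y < j)%N] \in ideal]
  (walk_times N S f).
Proof.
move=> NK; apply: (iffP andP) => [[/forallP H1 /forallP H2]|[H1 H2 H3]].
  split=> [y yS|y yS|j jN].
  - by have := H1 y; rewrite yS => /andP [-> /eqP].
  - by have := H1 y; rewrite (negPf yS) => /eqP.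
  - have jK : (j < K.+1)%N by rewrite ltnS (leq_trans jN).
    by have := H2 (Ordinal jK); rewrite jN.
split; apply/forallP => y; last by apply/implyP => /H3.
by case: (boolP (y \in S)) => [/H1 [-> ->]|/H2 ->] /=.
Qed.

Lemma walk_times_support N (S : {set Y}) (f : {ffun Y -> 'I_K.+1}) : (N <= K)%N -> walk_times N S f ->
  [set y | (f y < N)%N] = S.
Proof.
move=> NK /(walk_timesP _ _ NK) [H1 H2 _]; apply/setP => y; rewrite inE.
by case: (boolP (y \in S)) => [/H1 [-> _]|/H2 ->] //; rewrite ltnNge NK.
Qed.

Hypothesis ideal0 : set0 \in ideal.

(** Group the functions by the set [T] reached before the last step; replacing the dummy time by [N]
    on [S :\: T] identifies the functions for [T] with their group. *)
Lemma walk_count N S : (N <= K)%N -> S \in ideal ->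
  walk ty ideal N S = #|[set f | walk_times N S f]|%:R.
Proof.
elim: N S => [|N IHN] S NK SI /=.
  have [->|S0] := eqVneq S set0.
    rewrite (_ : [set f | _] = [set [ffun=> ord_max]]) ?cards1 //.
    apply/setP => f; rewrite !inE; apply/idP/eqP => [/(walk_timesP _ _ NK) [_ H _]|->].
      by apply/ffunP => y; apply: val_inj; rewrite ffunE /= H ?inE.
    apply/walk_timesP => //; split=> [y|y|j]; rewrite ?inE ?ffunE //.
    by rewrite leqn0 => /eqP ->; rewrite (_ : [set y | _] = set0).
  rewrite (_ : [set f | _] = set0) ?cards0 //.
  apply/setP => f; rewrite !inE; apply/negP => /(walk_timesP _ _ NK) [H _ _].
  by have [y /H []] := set0Pn _ S0.
have NK' := ltnW NK.
pose g (f : {ffun Y -> 'I_K.+1}) := [set y | (f y < N)%N].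
have stepg f : walk_times N.+1 S f -> step ty ideal (odd N) (g f) S.
  move=> /(walk_timesP _ _ NK) [H1 H2 H3]; apply/and3P; split.
  - exact: H3.
  - apply/subsetP => y; rewrite inE; apply: contraTT => /H2 ->.
    by rewrite -leqNgt.
  - apply/subsetP => y; rewrite !inE -leqNgt => /andP [Ny /H1 [yN <-]].
    by rewrite (_ : nat_of_ord (f y) = N) //; lia.
rewrite -sum1dep_card.
rewrite (partition_big g (fun T => step ty ideal (odd N) T S)) //= natr_sum.
apply: eq_bigr => T /and3P [TI TS ST]; rewrite expr1n mul1r IHN //; congr (_%:R).
rewrite -sum1dep_card.
pose h (f : {ffun Y -> 'I_K.+1}) : {ffun Y -> 'I_K.+1} :=
  [ffun y => if y \in S :\: T then inord N else f y].
pose k (f : {ffun Y -> 'I_K.+1}) : {ffun Y -> 'I_K.+1} :=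
  [ffun y => if y \in T then f y else ord_max].
have inordN : nat_of_ord (inord N : 'I_K.+1) = N by rewrite inordK.
rewrite [RHS](reindex_onto h k) /=; last first.
  move=> f /andP [/(walk_timesP _ _ NK) [H1 H2 H3] /eqP gf].
  apply/ffunP => y; rewrite !ffunE !inE; case: (boolP (y \in T)) => //= yT.
  apply: val_inj; case: (boolP (y \in S)) => yS /=; last by rewrite H2.
  have [yN _] := H1 y yS; move: yT; rewrite -gf inE inordN; lia.
apply: eq_bigl => f; apply/idP/andP.
  move=> Hf; have supp := walk_times_support NK' Hf.
  move: Hf => /(walk_timesP _ _ NK') [H1 H2 H3].
  have hE y : nat_of_ord (h f y) = if y \in S :\: T then N else f y.
    by rewrite ffunE; case: ifP.
  have hlt j : (j <= N)%N -> [set y | (h f y < j)%N] = [set y | (f y < j)%N].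
    move=> jN; apply/setP => y; rewrite !inE hE inE.
    by case: (boolP (y \in T)) => //= /H2 ->; case: ifP => // _; lia.
  split; last first.
    apply/eqP/ffunP => y; rewrite !ffunE inE; case: (boolP (y \in T)) => yT //=.
    by apply: val_inj; rewrite /= H2.
  apply/andP; split; last by rewrite /g hlt ?supp.
  apply/walk_timesP => //; split=> [y yS|y yS|j].
  - rewrite hE inE yS andbT; case: (boolP (y \in T)) => yT /=.
      by have [lt <-] := H1 y yT; split=> //; lia.
    by split=> //; apply/esym/eqP; have := subsetP ST y; rewrite !inE yS yT; apply.
  - rewrite hE inE (negPf yS) andbF H2 //; apply: contra yS; exact: (subsetP TS).
  - rewrite leq_eqVlt => /predU1P [->|]; last by rewrite ltnS => jN; rewrite hlt // H3.
    suff -> : [set y | (h f y < N.+1)%N] = S by [].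
    apply/setP => y; rewrite inE hE inE.
    case: (boolP (y \in T)) => yT /=.
      by have [lt _] := H1 y yT; rewrite (subsetP TS) //; lia.
    by case: ifP => _; rewrite ?ltnSn // H2 //; lia.
move=> [/andP [/(walk_timesP _ _ NK) [H1 H2 H3] /eqP gT] /eqP kh].
have fE y : y \in T -> nat_of_ord (f y) = h f y.
  by move=> yT; rewrite ffunE inE yT.
have fK y : y \notin T -> nat_of_ord (f y) = K.
  by move=> yT; rewrite -kh ffunE (negPf yT).
have flt j : (j <= N)%N -> [set y | (f y < j)%N] = [set y | (h f y < j)%N].
  move=> jN; apply/setP => y; rewrite !inE; case: (boolP (y \in T)) => yT; first by rewrite fE.
  rewrite fK // !ltnNge; congr (~~ _); apply/idP/idP => _; last by lia.
  by move: yT; rewrite -gT inE -leqNgt; apply: leq_trans.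
apply/walk_timesP => //; split=> [y yT|y yT|j jN].
- have [_ ty'] := H1 y (subsetP TS y yT); rewrite fE //; split=> //.
  by move: yT; rewrite -{1}gT inE.
- exact: fK.
- by rewrite flt // H3 // leqW.
Qed.

End WalkCount.

(** * Lattice points as slot assignments *)

Definition cyc_block (R : realType) (m a : nat) (c : R) : set 'M[R]_(m, a) :=
  [set x : 'M[R]_(m, a) | (forall i j, 0 <= x i j) /\
    (forall i : 'I_m, row_sum x i + row_sum x (ordS i) <= c)]%classic.
Arguments cyc_block : clear implicits.

Lemma row_sumZ (R : realType) m a c (x : 'M[R]_(m, a)) i :
  row_sum (c *: x) i = c * row_sum x i.
Proof. by rewrite /row_sum mulr_sumr; apply: eq_bigr => j _; rewrite mxE. Qed.

Lemma row_sumD (R : realType) m a (x y : 'M[R]_(m, a)) i :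
  row_sum (x + y) i = row_sum x i + row_sum y i.
Proof. by rewrite /row_sum -big_split; apply: eq_bigr => j _; rewrite mxE. Qed.

Lemma row_sum0 (R : realType) m a i : row_sum (0 : 'M[R]_(m, a)) i = 0.
Proof. by rewrite /row_sum big1 // => j _; rewrite mxE. Qed.

Lemma row_sum_ge0 (R : realType) m a (x : 'M[R]_(m, a)) i :
  (forall i j, 0 <= x i j) -> 0 <= row_sum x i.
Proof. by move=> x0; apply: sumr_ge0. Qed.

Lemma row_sum_ge (R : realType) m a (x : 'M[R]_(m, a)) i j :
  (forall i j, 0 <= x i j) -> x i j <= row_sum x i.
Proof.
by move=> x0; rewrite /row_sum (bigD1 j) //= lerDl sumr_ge0.
Qed.

Lemma cyc_block_le (R : realType) m a c (x : 'M[R]_(m, a)) i j :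
  cyc_block R m a c x -> x i j <= c.
Proof.
move=> [x0 xc]; apply: le_trans (row_sum_ge i j x0) _; apply: le_trans (xc i).
by rewrite lerDl row_sum_ge0.
Qed.

Lemma dilate_cyclic (R : realType) m a k :
  dilate k (cyclic_block_polytope R m a) = cyc_block R m a k%:R.
Proof.
apply/seteqP; split=> [_ [x [x0 xc] <-]|x xP].
  split=> [i j|i]; first by rewrite mxE mulr_ge0.
  by rewrite !row_sumZ -mulrDr ler_piMr.
(* The dilate by 0 is the origin alone, and the bound 0 admits nothing else. *)
have [k0|k0] := posnP k.
  exists 0; first by split=> [i j|i]; rewrite ?mxE ?row_sum0 ?addr0 ?ler01.
  apply/matrixP => i j; rewrite scaler0 mxE; apply: le_anti.
  by rewrite (proj1 xP) -[0]/(0%:R) -{1}k0 (cyc_block_le _ _ xP).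
case: xP => x0 xc; exists (k%:R^-1 *: x).
  split=> [i j|i]; first by rewrite mxE mulr_ge0 // invr_ge0.
  by rewrite !row_sumZ -mulrDr mulrC ler_pdivrMr ?ltr0n // mul1r.
by rewrite scalerA mulfV ?scale1r // pnatr_eq0 -lt0n.
Qed.

Lemma card_fset_set_image (T : finType) (U : choiceType) (f : T -> U) (D : {set T}) :
  {in D &, injective f} -> #|` fset_set (f @` [set` D])%classic|%fset = #|D|.
Proof.
move=> f_inj; rewrite -[(f @` _)%classic](_ : [set` [fset f x | x in D]%fset]%classic = _).
  by rewrite set_fsetK card_in_imfset //= -cardE.
apply/seteqP; split=> y /=.
  by move=> /imfsetP [x /= xD ->]; exists x.
by move=> [x /= xD <-]; apply/imfsetP; exists x.
Qed.

Section Slots.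
Import mathcomp.boot.fintype mathcomp.boot.finset.
Variables (m b : nat).
Local Notation T := ('I_m * 'I_b.+1)%type.

(* With [g (i, k) = 2 * (x i 0 + ... + x i k) + k], the lattice points [x] of
   the [q]-th dilate become the families below for [N = q + b + 1]. *)
Definition slots N (g : {ffun T -> 'I_N.*2.+1}) : bool :=
  [&& [forall t, odd (g t) == odd t.2],
      [forall i : 'I_m, forall k : 'I_b.+1, forall k' : 'I_b.+1,
         (k' == k.+1 :> nat) ==> (g (i, k) < g (i, k'))%N]
    & [forall i : 'I_m, g (i, ord_max) + g (ordS i, ord_max) < N.*2.-1]%N].

Lemma slotsP N (g : {ffun T -> 'I_N.*2.+1}) : reflect
  [/\ forall i k, odd (g (i, k)) = odd k,
      forall i (k k' : 'I_b.+1), k' = k.+1 :> nat -> (g (i, k) < g (i, k'))%N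
    & forall i, (g (i, ord_max) + g (ordS i, ord_max) < N.*2.-1)%N]
  (slots g).
Proof.
apply: (iffP and3P) => [[/forallP H1 /forallP H2 /forallP H3]|[H1 H2 H3]].
  split=> [i k|i k k' kk'|//]; first exact/eqP/(H1 (i, k)).
  by have /forallP /(_ k) /forallP /(_ k') := H2 i; rewrite kk' eqxx.
split; apply/forallP; [by case=> i k; rewrite H1|move=> i|exact: H3].
by apply/forallP => k; apply/forallP => k'; apply/implyP => /eqP /H2 ->.
Qed.

Definition prefix (n : T -> nat) i (k : nat) : nat := \sum_(l < b.+1 | (l <= k)%N) n (i, l).

Lemma prefix0 n i : prefix n i 0 = n (i, ord0).
Proof. by rewrite /prefix (big_pred1 ord0) // => l; rewrite /= -val_eqE /= leqn0. Qed.

Lemma prefixS n i (k : nat) (k' : 'I_b.+1) : k' = k.+1 :> nat ->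
  prefix n i k' = (prefix n i k + n (i, k'))%N.
Proof.
move=> kk'; rewrite /prefix (bigD1 k') //= addnC; congr (_ + _)%N.
by apply: eq_bigl => l; rewrite -val_eqE /= kk'; lia.
Qed.

Lemma prefix_max n i : prefix n i b = (\sum_l n (i, l))%N.
Proof. by apply: eq_bigl => l; rewrite -ltnS ltn_ord. Qed.

Lemma prefix_le n i k : (prefix n i k <= \sum_l n (i, l))%N.
Proof. by rewrite /prefix big_mkcond leq_sum // => l _; case: ifP. Qed.

Local Notation fam n := (fun t : T => nat_of_ord (n t)).

Definition lattice_families q : {set {ffun T -> 'I_q.+1}} :=
  [set n : {ffun T -> 'I_q.+1} |
    [forall i : 'I_m, \sum_l n (i, l) + \sum_l n (ordS i, l) <= q]%N].

(** The slots determine the point: remove 1 from each gap between consecutive slots of a row and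
    halve. *)
Lemma card_lattice_families q :
  #|lattice_families q| = #|[set g : {ffun T -> 'I_(q + b.+1).*2.+1} | slots g]|.
Proof.
pose F (n : {ffun T -> 'I_q.+1}) : {ffun T -> 'I_(q + b.+1).*2.+1} :=
  [ffun t : T => inord ((prefix (fam n) t.1 t.2).*2 + t.2)].
have bound n : n \in lattice_families q -> forall i, (\sum_l n (i, l) <= q)%N.
  by rewrite inE => /forallP H i; apply: leq_trans (H i); apply: leq_addr.
have FE n i k : n \in lattice_families q ->
    F n (i, k) = ((prefix (fam n) i k).*2 + k)%N :> nat.
  move=> nD; rewrite ffunE inordK //=.
  by have := bound n nD i; have := prefix_le (fam n) i k; have := ltn_ord k; rewrite /=; lia.
rewrite -(card_in_imset (f := F)); last first.
  move=> n n' nD nD' Fnn'.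
  have P i (k : 'I_b.+1) : prefix (fam n) i k = prefix (fam n') i k.
    by have := FE n i k nD; rewrite Fnn' FE //; lia.
  apply/ffunP => -[i [k kb]]; apply: val_inj => /=; case: k kb => [|k] kb.
    have := P i ord0; rewrite !prefix0.
    by rewrite (_ : Ordinal kb = ord0) //; apply: val_inj.
  have := P i (Ordinal kb); have := P i (Ordinal (ltnW kb)).
  by rewrite !(@prefixS _ _ k (Ordinal kb)) //= => ->; lia.
apply: eq_card => g; rewrite inE; apply/imsetP/slotsP => [[n nD ->]|[H1 H2 H3]].
  split=> [i k|i k k' kk'|i]; rewrite !FE //.
  - by rewrite oddD odd_double.
  - by rewrite (prefixS _ _ kk') kk'; lia.
  (* With row sums [A] and [B] the goal is [2 A + b + 2 B + b < 2 (q + b + 1) - 1], that is,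
     [A + B <= q]. *)
  - move: nD; rewrite inE => /forallP /(_ i); rewrite /= !prefix_max.
    by move: (\sum_l n (i, l))%N (\sum_l n (ordS i, l))%N => A B; lia.
pose n' (t : T) := ((if t.2 == 0%N :> nat then nat_of_ord (g t) else
  g t - (g (t.1, inord t.2.-1)).+1)./2)%N.
have P i (k : 'I_b.+1) : ((prefix n' i k).*2 + k = g (i, k))%N.
  case: k => k; elim: k => [|k IHk] kb.
    rewrite prefix0 /n' /= (_ : Ordinal kb = ord0); last exact: val_inj.
    by have := H1 i ord0; rewrite addn0 /=; lia.
  rewrite (prefixS _ _ (k := k)) //= doubleD.
  have := IHk (ltnW kb); have := H2 i (Ordinal (ltnW kb)) (Ordinal kb) erefl.
  rewrite {3}/n' /= (_ : inord k = Ordinal (ltnW kb)); last first.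
    by apply: val_inj; rewrite /= inordK // ltnW.
  by have := H1 i (Ordinal (ltnW kb)); have := H1 i (Ordinal kb); rewrite /=; lia.
have S i : ((\sum_l n' (i, l)).*2 + b = g (i, ord_max))%N.
  by rewrite -P /= prefix_max.
have nq i k : (n' (i, k) <= q)%N.
  have : (n' (i, k) <= \sum_l n' (i, l))%N by rewrite (bigD1 k) //= leq_addr.
  have := H3 i; rewrite -!S.
  by move: (\sum_l n' (i, l))%N (\sum_l n' (ordS i, l))%N => A B; lia.
pose n : {ffun T -> 'I_q.+1} := [ffun t : T => inord (n' t)].
have nE t : n t = n' t :> nat by case: t => i k; rewrite ffunE inordK // ltnS nq.
have nD : n \in lattice_families q.
  rewrite inE; apply/forallP => i.
  under eq_bigr do rewrite nE; under [X in (_ + X)%N]eq_bigr do rewrite nE.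
  have := H3 i; rewrite -!S.
  by move: (\sum_l n' (i, l))%N (\sum_l n' (ordS i, l))%N => A B; lia.
exists n => //; apply/ffunP => -[i k]; apply: val_inj.
rewrite /= FE // -P; congr (_.*2 + _)%N.
by apply: eq_bigr => l _; rewrite nE.
Qed.

Lemma ehrhart_count_slots (R : realType) q :
  ehrhart_count (cyclic_block_polytope R m b.+1) q =
  #|[set g : {ffun T -> 'I_(q + b.+1).*2.+1} | slots g]|.
Proof.
rewrite -card_lattice_families /ehrhart_count dilate_cyclic.
pose F (n : {ffun T -> 'I_q.+1}) : 'M[R]_(m, b.+1) := \matrix_(i, j) (n (i, j))%:R.
have rsF n i : row_sum (F n) i = (\sum_l n (i, l))%:R.
  by rewrite natr_sum; apply: eq_bigr => l _; rewrite mxE.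
rewrite -(card_fset_set_image (f := F)); last first.
  move=> n n' _ _ /matrixP Fn; apply/ffunP => -[i j]; apply: val_inj.
  by have := Fn i j; rewrite !mxE => /eqP; rewrite eqr_nat => /eqP.
congr (#|` fset_set _|); apply/seteqP; split=> [x [xP xL]|_ [n /= nD <-]].
  have x0 := proj1 xP.
  pose n' i j := Num.truncn (x i j).
  have n'E i j : x i j = (n' i j)%:R.
    have /mxOverP /(_ i j) xi := xL.
    by rewrite /n' Num.Theory.truncnK // -[x i j]ger0_norm // natr_norm_int.
  have nq i j : (n' i j <= q)%N.
    by have := cyc_block_le i j xP; rewrite n'E ler_nat.
  exists [ffun t : T => inord (n' t.1 t.2)]; last first.
    by apply/matrixP => i j; rewrite !mxE ffunE /= inordK // ltnS nq.
  rewrite /= inE; apply/forallP => i; have := proj2 xP i.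
  rewrite -(ler_nat R) natrD !natr_sum; congr (_ + _ <= _).
    by apply: eq_bigr => j _; rewrite ffunE /= inordK ?ltnS ?nq.
  by apply: eq_bigr => j _; rewrite ffunE /= inordK ?ltnS ?nq.
split; first split=> [i j|i]; first by rewrite mxE.
  by rewrite !rsF -natrD ler_nat; move: nD; rewrite inE => /forallP.
by apply/mxOverP => i j; rewrite mxE natr_int.
Qed.

End Slots.

(** * Slot assignments as walks *)

Section CyclicModel.
Import mathcomp.boot.fintype mathcomp.boot.finset.
Variables (m b : nat).
Local Notation T := ('I_m * 'I_b.+1)%type.

(* [(t, true)] stands for the reflection of the slot of [t] *)
Definition slotv N (g : T -> nat) (y : T * bool) : nat :=
  (if y.2 then N.*2.-1 - g y.1 else g y.1)%N.

(** Relations forced on the slots: rows increase, their reflections decrease, and the last entry of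
    a row lies below the reflected last entry of each neighbouring row, as the two slots sum to less
    than [2 N - 1]. *)
Definition below (x y : T * bool) : bool :=
  let: (i, k, s) := x in let: (i', k', s') := y in
  match s, s' with
  | false, false => (i == i') && (k' == k.+1 :> nat)
  | true, true => (i == i') && (k == k'.+1 :> nat)
  | false, true => [&& k == ord_max, k' == ord_max & (i' == ordS i) || (i == ordS i')]
  | true, false => false
  end.

(** The parity of the slot, which reflection at [2 N - 1] changes. *)
Definition signed_type (y : T * bool) : bool := odd y.1.2 (+) y.2.

Lemma below_type x y : below x y -> signed_type y = ~~ signed_type x.
Proof.
case: x y => [[i k] s] [[i' k'] s'] /=; rewrite /signed_type /=.
case: s s' => [] [] //=.
- by move=> /andP [_ /eqP ->] /=; case: (odd k').
- by move=> /and3P [/eqP -> /eqP -> _]; case: (odd _).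
- by move=> /andP [_ /eqP ->] /=; case: (odd k).
Qed.

Definition flip (y : T * bool) : T * bool := (y.1, ~~ y.2).

Lemma below_flip x y : below (flip y) (flip x) = below x y.
Proof.
case: x y => [[i k] s] [[i' k'] s'] /=; case: s s' => [] [] //=.
- by rewrite eq_sym.
- by rewrite andbCA orbC.
- by rewrite eq_sym.
Qed.

Section Slots.
Variables (N : nat) (g : {ffun T -> 'I_N.*2.+1}).
Local Notation gn := (fun t : T => nat_of_ord (g t)).

Lemma slots_le_max i k : slots g -> (g (i, k) <= g (i, ord_max))%N.
Proof.
move=> /slotsP [_ H2 _]; have [d] := ubnP (b - k); elim: d k => // d IHd k kd.
have [->//|kb] := eqVneq k ord_max.
have kb' : (k.+1 < b.+1)%N.
  by rewrite ltnS ltn_neqAle -ltnS ltn_ord andbT -(inj_eq val_inj) in kb *.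
apply: leq_trans (ltnW (H2 i k (Ordinal kb') erefl)) (IHd _ _) => /=; lia.
Qed.

Lemma slots_lt t : slots g -> (g t < N.*2.-1)%N.
Proof.
case: t => i k gs; have /slotsP [_ _ H3] := gs.
by have := slots_le_max i k gs; have := H3 i; lia.
Qed.

Lemma slots_below x y : slots g -> below x y -> (slotv N gn x < slotv N gn y)%N.
Proof.
move=> gs; have /slotsP [_ H2 H3] := gs.
case: x y => [[i k] s] [[i' k'] s']; rewrite /slotv /=.
have := slots_lt (i, k) gs; have := slots_lt (i', k') gs.
case: s s' => [] [] //= lt lt'.
- move=> /andP [/eqP ii' /eqP kk']; subst i'.
  exact: ltn_sub2l (H2 i k' k kk').
- move=> /and3P [/eqP -> /eqP -> /orP [] /eqP ->]; rewrite ltn_subRL //.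
  by rewrite addnC.
- by move=> /andP [/eqP -> /eqP kk']; exact: H2.
Qed.

Lemma odd_slotv y : slots g -> odd (slotv N gn y) = signed_type y.
Proof.
move=> gs; have /slotsP [H1 _ _] := gs; have := slots_lt y.1 gs.
case: y => [[i k] []]; rewrite /slotv /signed_type /= => lt; last by rewrite H1 addbF.
by rewrite addbT -(H1 i k); move: lt; move: (nat_of_ord (g (i, k))) => A; lia.
Qed.

End Slots.

(** * Order ideals of signed elements *)

Section Ideals.
Variables (Y : finType) (e : Y -> T * bool).

(** The slots of an element and its reflection sum to [2 N - 1], so only one of them is among the
    first [N]; the second clause records this. *)
Definition signed_ideal : {pred {set Y}} := [pred S : {set Y} |
  [forall x, forall y, below (e x) (e y) ==> (y \in S) ==> (x \in S)] &&
  [forall x in S, forall y in S, ((e x).1 == (e y).1) ==> (x == y)]].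

Lemma signed_idealP (S : {set Y}) : reflect
  ((forall x y, below (e x) (e y) -> y \in S -> x \in S) /\
   {in S &, injective (fun x => (e x).1)})
  (S \in signed_ideal).
Proof.
apply: (iffP andP) => [[/forallP H1 /forall_inP H2]|[H1 H2]]; split.
- move=> x y xy; have /forallP /(_ y) := H1 x.
  by rewrite xy /=; apply/implyP.
- move=> x y xS yS /= exy; have /forall_inP /(_ y yS) := H2 x xS.
  by rewrite exy eqxx => /eqP.
- apply/forallP => x; apply/forallP => y; apply/implyP => xy.
  by apply/implyP; apply: H1.
- apply/forall_inP => x xS; apply/forall_inP => y yS.
  by apply/implyP => /eqP /(H2 _ _ xS yS) ->.
Qed.

Lemma signed_ideal0 : set0 \in signed_ideal.
Proof. by apply/signed_idealP; split=> [x y _|x y]; rewrite inE. Qed.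

(** Related elements have opposite types, so the elements added by a step of one type are pairwise
    unrelated. *)
Lemma signed_ideal_between bt (U V S : {set Y}) :
  U \in signed_ideal -> S \in signed_ideal -> U \subset V -> V \subset S ->
  S :\: U \subset tyset (signed_type \o e) bt -> V \in signed_ideal.
Proof.
move=> /signed_idealP [U1 _] /signed_idealP [S1 S2] UV VS SU.
apply/signed_idealP; split=> [x y xy yV|x y xV yV]; last by apply: S2; apply: (subsetP VS).
apply: contraT => xV.
have xU : x \notin U by apply: contra xV; exact: (subsetP UV).
have yU : y \notin U by apply: contra xU; exact: U1.
have yS := subsetP VS y yV; have xS := S1 x y xy yS.
have := subsetP SU x; have := subsetP SU y; rewrite !inE xU yU xS yS /=.
move=> /(_ isT) /eqP ey /(_ isT) /eqP ex.
by have := below_type xy; rewrite ey ex; case: (bt).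
Qed.

Hypothesis e_below : forall y, signed_type (e y) -> exists x, below (e x) (e y).

Lemma signed_ideal_true (S : {set Y}) :
  S \in signed_ideal -> S \subset tyset (signed_type \o e) true -> S = set0.
Proof.
move=> /signed_idealP [S1 _] /subsetP St; apply/eqP; rewrite -subset0.
apply/subsetP => y yS; have := St y yS; rewrite inE /= => /eqP ty.
have [x xy] := e_below ty.
have := St x (S1 x y xy yS); rewrite inE => /eqP tx.
by have := below_type xy; rewrite ty [signed_type (e x)]tx.
Qed.

End Ideals.

(** * Even number of rows: walks through all slots *)

Section Even.
Hypothesis m_even : ~~ odd m.

(** For even [m] neighbouring rows get opposite signs, so everything related to an element of the
    image lies in the image. *)
Definition even_embed (t : T) : T * bool := (t, odd t.1).
Local Notation e := even_embed.
Local Notation ideal := (signed_ideal e).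
Local Notation ty := (signed_type \o e).

Lemma odd_ordS (i : 'I_m) : odd (ordS i) = ~~ odd i.
Proof.
rewrite /=; have := ltn_ord i; rewrite leq_eqVlt => /predU1P [im|im].
  have : ~~ odd i.+1 by rewrite im.
  by move=> oi; rewrite im modnn; move: oi; rewrite /= negbK => ->.
by rewrite modn_small.
Qed.

Lemma even_below t : signed_type (e t) -> exists x, below (e x) (e t).
Proof.
case: t => i [k kb]; rewrite /signed_type /=; case: (boolP (odd i)) => io; rewrite ?addbT ?addbF => ko.
  have [kb1|kb1] := ltnP k.+1 b.+1.
    by exists (i, Ordinal kb1); rewrite /= io !eqxx.
  exists (ordS i, ord_max); rewrite /= odd_ordS io !eqxx orbT andbT /=.
  by rewrite -(inj_eq val_inj) /=; lia.
case: k kb ko => // k kb ko; exists (i, Ordinal (ltnW kb)).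
by rewrite /= (negPf io) !eqxx.
Qed.

Lemma even_above t : ~~ signed_type (e t) -> exists x, below (e t) (e x).
Proof.
case: t => i [k kb]; rewrite /signed_type /=; case: (boolP (odd i)) => io; rewrite ?addbT ?addbF ?negbK => ko.
  case: k kb ko => // k kb ko; exists (i, Ordinal (ltnW kb)).
  by rewrite /= io !eqxx.
have [kb1|kb1] := ltnP k.+1 b.+1.
  by exists (i, Ordinal kb1); rewrite /= (negPf io) !eqxx.
exists (ordS i, ord_max); rewrite /= odd_ordS io !eqxx andbT.
by rewrite -(inj_eq val_inj) /=; lia.
Qed.

Lemma even_ideal_setT : setT \in ideal.
Proof. by apply/signed_idealP; split=> [x y _|x y _ _ //]; rewrite !inE. Qed.

(** A missing element of type [false] has one of type [true] above it, which is missing too and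
    cannot be added by this step. *)
Lemma even_step_setT S : step ty ideal false S setT -> S = setT.
Proof.
move=> /and3P [/signed_idealP [S1 _] _ /subsetP St].
apply/eqP; rewrite -subTset; apply/subsetP => y _; apply: contraT => yS.
have := St y; rewrite !inE yS /= => /(_ isT) /eqP ty0.
have [|z yz] := @even_above y; first by rewrite [signed_type _]ty0.
have zS : z \notin S by apply: contra yS; exact: S1.
have := St z; rewrite !inE zS /= => /(_ isT) /eqP tz.
by have := below_type yz; rewrite [signed_type (e y)]ty0 [signed_type (e z)]tz.
Qed.

Lemma below_even_chain (i : 'I_m) (k k' : 'I_b.+1) : k' = k.+1 :> nat ->
  (odd i -> below (e (i, k')) (e (i, k))) /\ (~~ odd i -> below (e (i, k)) (e (i, k'))).
Proof. by move=> kk'; split=> [|/negPf] io; rewrite /= io !eqxx kk' /= eqxx. Qed.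

Lemma below_even_wrap (i : 'I_m) :
  (odd i -> below (e (ordS i, ord_max)) (e (i, ord_max))) /\
  (~~ odd i -> below (e (i, ord_max)) (e (ordS i, ord_max))).
Proof. by split=> [|/negPf] io; rewrite /= odd_ordS io /= !eqxx ?orbT. Qed.

(** Reflecting the odd rows turns slot assignments into times of walks through all [2 N] slots;
    doing so twice is the identity. *)
Lemma card_slots_even N :
  #|[set g : {ffun T -> 'I_N.*2.+1} | slots g]|%:R = walk ty ideal N.*2 setT.
Proof.
rewrite (@walk_count _ _ _ N.*2) ?signed_ideal0 ?even_ideal_setT //; congr (_%:R).
pose h (f : {ffun T -> 'I_N.*2.+1}) : {ffun T -> 'I_N.*2.+1} :=
  [ffun t => inord (slotv N (fun t => nat_of_ord (f t)) (e t))].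
have hE (f : {ffun T -> 'I_N.*2.+1}) t : (f t <= N.*2.-1)%N ->
    h f t = slotv N (fun t => nat_of_ord (f t)) (e t) :> nat.
  move=> ft; rewrite ffunE inordK // /slotv /=; move: ft.
  by case: ifP => _; move: (nat_of_ord (f t)) => A; lia.
have hK (f : {ffun T -> 'I_N.*2.+1}) : (forall t, f t <= N.*2.-1)%N -> h (h f) = f.
  move=> ft; apply/ffunP => t; apply: val_inj; rewrite /= hE.
    rewrite /slotv /= hE // /slotv /=; have := ft t; case: (odd t.1) => //.
    by move: (nat_of_ord (f t)) => A; lia.
  rewrite hE // /slotv /=; have := ft t.
  by case: ifP => _; move: (nat_of_ord (f t)) => A; lia.
have sl (g : {ffun T -> 'I_N.*2.+1}) : slots g -> forall t, (g t <= N.*2.-1)%N.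
  by move=> gs t; apply: ltnW; apply: slots_lt.
have wl (f : {ffun T -> 'I_N.*2.+1}) : walk_times ty ideal N.*2 setT f -> forall t, (f t <= N.*2.-1)%N.
  move=> /(walk_timesP _ _ _ _ (leqnn _)) [H1 _ _] t.
  have [] := H1 t; first by rewrite inE.
  by move: (nat_of_ord (f t)) => A; lia.
rewrite -(card_in_imset (f := h)); last first.
  by move=> g g'; rewrite !inE => gs gs' E; rewrite -(hK g) ?E ?hK //; apply: sl.
apply: eq_card => f; rewrite [RHS]inE; apply/imsetP/idP => [[g]|fw].
  rewrite inE => gs ->; apply/(walk_timesP _ _ _ _ (leqnn _)).
  have gE t := hE g t (sl g gs t).
  split=> [t _|t|j jN]; last 1 first.
  - apply/signed_idealP; split=> [x y xy|x y _ _ //]; rewrite !inE !gE.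
    exact/ltn_trans/slots_below.
  - rewrite gE odd_slotv //; split=> //.
    by have := slots_lt t gs; rewrite /slotv /=; case: ifP => _; move: (nat_of_ord (g t)) => A; lia.
  - by rewrite inE.
exists (h f); last by rewrite hK //; apply: wl.
have fl := wl f fw; have fE t := hE f t (fl t).
move: fw => /(walk_timesP _ _ _ _ (leqnn _)) [H1 _ H3].
have parity t : odd (f t) = ty t by have [] := H1 t; rewrite ?inE.
have lt2 t : (f t < N.*2)%N by have [] := H1 t; rewrite ?inE.
(* The elements with time at most [f y] form an ideal, so [f x <= f y]; opposite parities exclude
   equality. *)
have fb x y : below (e x) (e y) -> (f x < f y)%N.
  move=> xy; have /signed_idealP [I1 _] := H3 (f y).+1 (lt2 y).
  have := I1 x y xy; rewrite !inE ltnSn => /(_ isT); rewrite ltnS leq_eqVlt.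
  case/orP => // /eqP E; have := below_type xy.
  by rewrite -[signed_type (e x)](parity x) -[signed_type (e y)](parity y) E; case: (odd _).
rewrite inE; apply/slotsP; split=> [i k|i k k' kk'|i].
- rewrite fE /slotv /=; have := parity (i, k); have := lt2 (i, k); rewrite /= /signed_type /=.
  case: (odd i); rewrite ?addbT ?addbF // => lt pa.
  rewrite -[RHS]negbK -pa; move: lt; move: (nat_of_ord (f _)) => A; lia.
- have [chain1 chain0] := below_even_chain i kk'; have := lt2 (i, k).
  rewrite !fE /slotv /=; case: (boolP (odd i)) => [/chain1|/chain0] /fb ff lt //.
  by move: ff lt; move: (nat_of_ord (f (i, k))) (nat_of_ord (f (i, k'))) => A B; lia.
- have [wrap1 wrap0] := below_even_wrap i.
  have := lt2 (i, ord_max); have := lt2 (ordS i, ord_max).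
  have eE i' k' : slotv N (fun t : T => nat_of_ord (f t)) (e (i', k')) =
    (if odd i' then N.*2.-1 - f (i', k') else f (i', k'))%N by [].
  rewrite !fE !eE odd_ordS.
  case: (boolP (odd i)) => [/wrap1|/wrap0] /fb /= ff lt lt'; move: ff lt lt';
    by move: (nat_of_ord (f (i, _))) (nat_of_ord (f (ordS i, _))) => A B; lia.
Qed.

End Even.

(** * Entries together with their reflections: walks through half of the slots *)

Section Signed.
Local Notation Y := (T * bool)%type.
Local Notation ideal := (signed_ideal (@id Y)).
Local Notation ty := (signed_type \o @id Y).

Lemma signed_below (y : Y) : signed_type y -> exists x, below x y.
Proof.
case: y => [[i [k kb]] []]; rewrite /signed_type /= ?addbT ?addbF => ko.
  have [kb1|kb1] := ltnP k.+1 b.+1.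
    by exists (i, Ordinal kb1, true); rewrite /= !eqxx.
  exists (ordS i, ord_max, false); rewrite /= !eqxx orbT andbT /=.
  by rewrite -(inj_eq val_inj) /=; lia.
case: k kb ko => // k kb ko; exists (i, Ordinal (ltnW kb), false).
by rewrite /= !eqxx.
Qed.

(** An ideal meets each pair of reflections at most once; having as many elements as there are
    pairs, it meets each exactly once. *)
Lemma signed_full (S : {set Y}) : S \in ideal -> #|S| = #|{: T}| ->
  forall y, (flip y \in S) = (y \notin S).
Proof.
move=> /signed_idealP [_ S2] Sc [t s]; rewrite /flip /=.
have nodouble : ~~ (((t, s) \in S) && ((t, ~~ s) \in S)).
  by apply/negP => /andP [yS fS]; have := S2 _ _ yS fS erefl => -[]; case: (s).
have full : [set y.1 | y in S] = setT.
  by apply/eqP; rewrite eqEcard subsetT cardsT (card_in_imset S2) Sc leqnn.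
have : t \in [set y.1 | y in S] by rewrite full inE.
case/imsetP => -[t' s'] yS /= tt'; subst t'; move: nodouble.
by case: s yS => /=; case: s' => yS /=; rewrite yS ?andbT ?andbF //=; move=> /negPf ->.
Qed.

(** Of an entry and its reflection exactly one has its slot among the first [N]. These elements form
    the final set [S], and the first half of the slots determines the second by reflection. *)
Lemma card_slots_signed N :
  #|[set g : {ffun T -> 'I_N.*2.+1} | slots g]|%:R =
  \sum_(S | (S \in ideal) && (#|S| == #|{: T}|)) walk ty ideal N S.
Proof.
pose sl (g : {ffun T -> 'I_N.*2.+1}) := slotv N (fun t => nat_of_ord (g t)).
pose low g : {set Y} := [set y | (sl g y < N)%N].
have slflip g y : slots g -> sl g (flip y) = (N.*2.-1 - sl g y)%N.
  move=> gs; have := slots_lt y.1 gs; case: y => t [] //=; rewrite /sl /slotv /=.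
  by move: (nat_of_ord (g t)) => A; lia.
have slb g y : slots g -> (sl g y < N.*2)%N.
  move=> gs; have := slots_lt y.1 gs; rewrite /sl /slotv; case: (y.2);
    by move: (nat_of_ord (g y.1)) => A; lia.
have low_flip g y : slots g -> (flip y \in low g) = (y \notin low g).
  by move=> gs; rewrite !inE slflip //; have := slb g y gs; move: (sl g y) => A; lia.
have low_ideal g j : slots g -> (j <= N)%N -> [set y | (sl g y < j)%N] \in ideal.
  move=> gs jN; apply/signed_idealP; split=> [x y xy|[t s] [t' s']]; rewrite !inE.
    by apply/ltn_trans/slots_below.
  move=> tS tS' /= tt'; subst t'; congr pair; apply/eqP; apply: contraT => ss'.
  have E : (t, s') = flip (t, s) by congr pair; case: (s) (s') ss' => [] [].
  have := low_flip g (t, s) gs; rewrite -E !inE (leq_trans tS jN) (leq_trans tS' jN).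
  by [].
have low_card g : slots g -> #|low g| = #|{: T}|.
  move=> gs; have := low_ideal g N gs (leqnn N) => /signed_idealP [_ inj].
  rewrite -(card_in_imset inj) -cardsT; apply: eq_card => t; rewrite [RHS]inE.
  apply/imsetP; have := low_flip g (t, true) gs; rewrite /flip /=.
  case: (boolP ((t, true) \in low g)) => [tl _|_ tl]; first by exists (t, true).
  by exists (t, false).
rewrite -sum1dep_card (partition_big low (fun S => (S \in ideal) && (#|S| == #|{: T}|))) /=; last first.
  by move=> g gs; rewrite low_card // eqxx andbT; apply: low_ideal.
rewrite natr_sum; apply: eq_bigr => S /andP [SI /eqP Sc].
rewrite (@walk_count _ _ _ N) ?signed_ideal0 // -sum1dep_card; congr (_%:R).
(* [k] cuts slots off at the dummy time [N]; [h] recovers a slot beyond from the time of the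
   reflected element. *)
pose k (g : {ffun T -> 'I_N.*2.+1}) : {ffun Y -> 'I_N.+1} := [ffun y => inord (minn N (sl g y))].
pose h (f : {ffun Y -> 'I_N.+1}) : {ffun T -> 'I_N.*2.+1} :=
  [ffun t => inord (if (f (t, false) < N)%N then nat_of_ord (f (t, false))
                    else (N.*2.-1 - f (t, true))%N)].
have kE g y : k g y = minn N (sl g y) :> nat by rewrite ffunE inordK // ltnS geq_minl.
have hE f t : h f t = (if (f (t, false) < N)%N then nat_of_ord (f (t, false))
                    else (N.*2.-1 - f (t, true))%N) :> nat.
  rewrite ffunE inordK //.
  by case: ifP; move: (nat_of_ord (f (t, false))) (nat_of_ord (f (t, true))) => A B; lia.
rewrite (reindex_onto h k) /=; last first.
  move=> g /andP [gs _]; apply/ffunP => t; apply: val_inj; rewrite /= hE !kE.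
  have := slb g (t, false) gs; rewrite /sl /slotv /=; move: (nat_of_ord (g t)) => A.
  by case: ifP; lia.
apply: eq_bigl => f; apply/idP/idP => [/andP [/andP [hs /eqP lowS] /eqP <-]|fw].
  apply/walk_timesP => //; have inS y : (y \in S) = (sl (h f) y < N)%N by rewrite -lowS inE.
  split=> [y|y|j jN].
  - rewrite inS kE => lt; rewrite (minn_idPr (ltnW lt)); split=> //.
    exact: odd_slotv.
  - by rewrite inS kE -leqNgt => /minn_idPl.
  - rewrite (_ : [set y | _] = [set y | (sl (h f) y < j)%N]) ?low_ideal //.
    by apply/setP => y; rewrite !inE kE; move: (sl _ _) => A; lia.
have flipS := signed_full SI Sc.
move: fw => /(walk_timesP _ _ _ _ (leqnn _)) [H1 H2 H3].
have NP (t : T) : (0 < N)%N.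
  have := flipS (t, false); case: (boolP ((t, false) \in S)) => [|_ ft].
    by move=> /H1 [lt _] _; apply: leq_ltn_trans lt.
  by have [lt _] := H1 _ ft; apply: leq_ltn_trans lt.
have slE y : sl (h f) y = if y \in S then nat_of_ord (f y) else (N.*2.-1 - f (flip y))%N.
  have lt z : (f z < N)%N = (z \in S).
    by case: (boolP (z \in S)) => [/H1 [-> //]|/H2 ->]; rewrite ltnn.
  case: y => t s; rewrite /sl /slotv /= hE lt.
  have := flipS (t, false); rewrite /flip /=.
  case: (boolP ((t, false) \in S)) => tS /= tS'; case: s; rewrite ?tS' ?tS ?(negPf tS) //.
  by have := lt (t, true); rewrite tS'; move: (nat_of_ord (f (t, true))) => A; lia.
have slN y : (sl (h f) y < N)%N = (y \in S).
  rewrite slE; case: (boolP (y \in S)) => [/H1 [] //|yS].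
  have [|lt _] := H1 (flip y); first by rewrite flipS.
  by move: lt; move: (nat_of_ord (f _)) => A; lia.
have fb x y : below x y -> y \in S -> (sl (h f) x < sl (h f) y)%N.
  move=> xy yS; have [lty tyy] := H1 y yS.
  have /signed_idealP [I1 _] := H3 (f y).+1 lty.
  have /signed_idealP [S1 _] := SI; have xS := S1 x y xy yS; have [ltx tyx] := H1 x xS.
  have := I1 x y xy; rewrite !inE ltnSn => /(_ isT); rewrite !slE xS yS ltnS leq_eqVlt.
  case/orP => // /eqP E; have := below_type xy.
  by rewrite -[signed_type x]tyx -[signed_type y]tyy E; case: (odd _).
have slfl y : sl (h f) (flip y) = (N.*2.-1 - sl (h f) y)%N.
  rewrite !slE flipS; have -> : flip (flip y) = y by case: y => t [].
  case: (boolP (y \in S)) => //= yS.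
  have [|lt _] := H1 (flip y); first by rewrite flipS.
  by move: lt; move: (nat_of_ord (f _)) => A; lia.
have slb' y : (sl (h f) y < N.*2)%N.
  have := NP y.1; rewrite slE; case: (boolP (y \in S)) => [/H1 [lt _]|_].
    by move: lt; move: (nat_of_ord (f y)) => A; lia.
  by move: (nat_of_ord (f (flip y))) => A; lia.
(* Relations between elements outside [S] are reflections of relations inside, with the order
   reversed. *)
have fb' x y : below x y -> (sl (h f) x < sl (h f) y)%N.
  move=> xy; case: (boolP (y \in S)) => yS; first exact: fb.
  case: (boolP (x \in S)) => xS.
    by have := slN x; have := slN y; rewrite xS (negPf yS); move: (sl _ x) (sl _ y) => A B; lia.
  have := fb (flip y) (flip x); rewrite below_flip flipS => /(_ xy xS).
  by rewrite !slfl; have := slb' x; have := slb' y; move: (sl _ x) (sl _ y) => A B; lia.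
have par y : odd (sl (h f) y) = signed_type y.
  rewrite slE; case: (boolP (y \in S)) => yS; first by have [] := H1 y yS.
  have [|lt tyf] := H1 (flip y); first by rewrite flipS.
  have -> : signed_type y = ~~ signed_type (flip y).
    by case: (y) => t s; rewrite /signed_type /=; case: (odd _) (s) => [] [].
  by rewrite -[signed_type _]tyf; move: lt; move: (nat_of_ord (f _)) => A; lia.
apply/andP; split; last first.
  apply/eqP/ffunP => y; apply: val_inj; rewrite /= kE.
  case: (boolP (y \in S)) => yS.
    by have [lt _] := H1 y yS; rewrite slE yS; apply/minn_idPr/ltnW.
  by rewrite H2 //; apply/minn_idPl; rewrite leqNgt slN.
apply/andP; split; last by apply/eqP/setP => y; rewrite inE slN.
apply/slotsP; split=> [i c|i c c' cc'|i].
- by have := par (i, c, false); rewrite /signed_type /= addbF.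
- by apply: (fb' (i, c, false) (i, c', false)); rewrite /= cc' !eqxx.
- have := fb' (i, ord_max, false) (ordS i, ord_max, true); rewrite /= !eqxx => /(_ isT).
  by rewrite /sl /slotv /= ltn_subRL addnC.
Qed.

End Signed.

End CyclicModel.

(** * Ehrhart functions *)

Lemma poly_eq_inj (u : nat -> rat) (p q : {poly rat}) : injective u ->
  (forall k, p.[u k] = q.[u k]) -> p = q.
Proof.
move=> u_inj pq; apply/eqP; rewrite -subr_eq0; apply/eqP.
apply: (@roots_geq_poly_eq0 _ _ (map u (iota 0 (size (p - q))))).
- by apply/allP => _ /mapP [k _ ->]; rewrite rootE !hornerE pq subrr.
- by rewrite map_inj_uniq ?iota_uniq.
- by rewrite size_map size_iota.
Qed.

Lemma walkz_reflect (Y : finType) (ty : Y -> bool) (ideal : {pred {set Y}}) (z : int) S :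
  walkz ty ideal (- z) S = (-1) ^+ #|S| * walkz ty ideal (z - 1) S.
Proof.
case: z => n; first exact: walkz_opp.
have -> : Negz n - 1 = Negz n.+1 by rewrite !NegzE -[n.+2]addn1 PoszD opprD.
rewrite NegzE opprK; move: n.+1 => k /=.
by rewrite mulrA -exprD addnn -mul2n exprM sqrrN !expr1n mul1r.
Qed.

(** The last slot of each row is at least [b], while two neighbouring ones sum to less than
    [2 N - 1]. *)
Lemma slots_lower_bound m b N (g : {ffun 'I_m * 'I_b.+1 -> 'I_N.*2.+1}) :
  (0 < m)%N -> slots g -> (b < N)%N.
Proof.
move=> m0 /slotsP [_ H2 H3].
have lb i (k : 'I_b.+1) : (k <= g (i, k))%N.
  case: k => k; elim: k => [//|k IHk] kb.
  exact: leq_ltn_trans (IHk (ltnW kb)) (H2 i (Ordinal (ltnW kb)) (Ordinal kb) erefl).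
have := H3 (Ordinal m0); have := lb (Ordinal m0) ord_max; have := lb (ordS (Ordinal m0)) ord_max.
rewrite /=; move: (nat_of_ord (g (Ordinal m0, _))) (nat_of_ord (g (ordS (Ordinal m0), _))) => A B.
lia.
Qed.

(** * Ehrhart polynomial and numerator for an even number of rows *)

Section EhrhartEven.
Variables (R : realType) (m b : nat).
Hypotheses (m0 : (0 < m)%N) (m_even : ~~ odd m).
Local Notation T := ('I_m * 'I_b.+1)%type.
Local Notation P := (cyclic_block_polytope R m b.+1).
Local Notation ty := (@signed_type m b \o @even_embed m b).
Local Notation ideal := (signed_ideal (@even_embed m b)).
Local Notation n := (b.+1 * m)%N.

Let between := @signed_ideal_between m b T (@even_embed m b).
Let ideal_set0 := @signed_ideal0 m b T (@even_embed m b).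
Let ideal_true := @signed_ideal_true m b T (@even_embed m b) (even_below m_even).
Let setT_ideal := @even_ideal_setT m b.

Lemma ehrhart_count_even q :
  (ehrhart_count P q)%:R = walk ty ideal (q + b.+1).*2 [set: T].
Proof. by rewrite ehrhart_count_slots card_slots_even. Qed.

(** Time reversal leads to an odd time. The last step before it has type [false] and ends in the
    full set, so it is trivial and may be dropped. *)
Lemma ehrhart_polynomial_even : exists f : {poly rat},
  ehrhart_polynomial P f /\
  f \Po (- 'X) = (-1) ^+ n *: (f \Po ('X - (2 * b.+1 + 1)%N%:R%:P)).
Proof.
have [p Ep] := walkz_polyfun between ideal_set0 ideal_true false setT_ideal.
exists (p \Po ('X + b.+1%:R%:P)); split.
  move=> q; rewrite ehrhart_count_even horner_comp !hornerE -natrD.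
  have := Ep (q + b.+1)%N; rewrite -pmulrn => <-.
  by rewrite addr0 -PoszM muln2.
apply: (@poly_eq_inj (fun k => k%:R)) => [k k' /eqP|k]; first by rewrite eqr_nat => /eqP.
rewrite !(hornerE, horner_comp).
have -> : - k%:R + b.+1%:R = (b.+1%:Z - k%:Z)%:~R :> rat.
  by rewrite intrD rmorphN addrC.
have -> : k%:R - (2 * b.+1 + 1)%N%:R + b.+1%:R = (k%:Z - b.+1%:Z - 1)%:~R :> rat.
  rewrite !intrD !rmorphN /= -!pmulrn natrD natrM; ring.
rewrite -!Ep !addr0.
have -> : (b.+1%:Z - k%:Z) * 2 = - ((k%:Z - b.+1%:Z) * 2) by ring.
rewrite walkz_reflect cardsT card_prod !card_ord mulnC; congr (_ * _).
have -> : (k%:Z - b.+1%:Z) * 2 - 1 = (k%:Z - b.+1%:Z - 1) * 2 + 1 by ring.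
rewrite (walkzS between ideal_set0 ideal_true) //.
rewrite abszM oddM andbF step_sum1_recl // big_pred0 ?addr0 // => S.
by apply/negP => /andP [/(even_step_setT m_even) -> /eqP].
Qed.

Lemma walk_even_small N : (N <= b)%N -> walk ty ideal N.*2 [set: T] = 0.
Proof.
move=> Nb; rewrite -card_slots_even // eq_card0 // => g; rewrite inE.
by apply/negP => /(slots_lower_bound m0); rewrite ltnNge Nb.
Qed.

(** The series of walks is [z^(b+1)] times the Ehrhart series. So its numerator, symmetric about
    [n / 2], begins and hence also ends with [b + 1] zero coefficients; removing them leaves
    [n - 2 (b + 1)] as the bound on the degree. *)
Lemma ehrhart_numerator_even : exists h : {poly rat},
  [/\ ps_eq_frac (ehrhart_series P) h ((1 - 'X) ^+ (n + 1)%N),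
      forall j, (b.+1 * (m - 2) < j)%N -> h`_j = 0,
      forall j, (j <= b.+1 * (m - 2))%N -> h`_j = h`_(b.+1 * (m - 2) - j),
      h`_0 = (ehrhart_count P 0)%:R
    & forall i j, (i <= j)%N -> (i + j <= b.+1 * (m - 2))%N -> h`_i <= h`_j].
Proof.
have T0 : [set: T] != finset.set0.
  by apply/set0Pn; exists (Ordinal m0, ord0); rewrite inE.
have [|p Ep Hp] := walk_series_sym_unimodal between ideal_set0 ideal_true setT_ideal T0.
  exact: even_step_setT.
have cT : #|[set: T]| = n by rewrite cardsT card_prod !card_ord mulnC.
rewrite cT in Ep Hp.
pose E := PS (ehrhart_series P).
have EW : PS (fun N => walk ty ideal N.*2 [set: T]) = psX ^+ b.+1 * E.
  apply: ps_ext => N; rewrite ps_coefXnM /=; case: ltnP => Nb; first exact: walk_even_small.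
  by rewrite /ehrhart_series ehrhart_count_even subnK.
have pE j : p`_j = if (j <= b)%N then 0 else ps_coef ((1 - psX) ^+ n.+1 * E) (j - b.+1).
  have := congr1 (fun f => ps_coef f j) Ep; rewrite /= => <-.
  rewrite -[ps_mul _ _ j]/(ps_coef ((1 - psX) ^+ n.+1 * PS (fun N => walk ty ideal N.*2 [set: T])) j).
  by rewrite EW mulrCA ps_coefXnM.
have hE j : (drop_poly b.+1 p)`_j = ps_coef ((1 - psX) ^+ n.+1 * E) j.
  by rewrite coef_drop_poly pE addnK ifF //; apply/negbTE; lia.
exists (drop_poly b.+1 p); have HpS := Hp; case: Hp => p0 psym _ _.
pose d := (b.+1 * (m - 2))%N; have nd : (n = d + (b.+1 + b.+1))%N.
  by rewrite /d; move: m0 m_even; case: (m) => [|[|k]] //= _ _; rewrite !mulnS subSS subSS subn0; lia.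
rewrite -/d; have hp j : (drop_poly b.+1 p)`_j = p`_(j + b.+1) by rewrite coef_drop_poly.
have plow j : (j <= b)%N -> p`_j = 0 by move=> jb; rewrite pE jb.
split.
- split; first by rewrite -horner_coef0 horner_exp !hornerE ?subr0 ?expr1n oner_neq0.
  apply/funext => j; rewrite /ps_of_poly hE addn1 mulrC.
  have -> : 1 - psX = ps_poly (1 - 'X) by rewrite rmorphB rmorph1.
  by rewrite -rmorphXn.
- move=> j dj; rewrite hp; case: (leqP (j + b.+1) n) => [jn|/p0 //].
  by rewrite psym // plow //; lia.
- by move=> j jd; rewrite !hp psym; [congr (p`__)|]; lia.
- rewrite hE (@ps_conv_trunc 1) // coefM big_ord1 !coef_poly /=.
  rewrite -[ps_coef _ _]/(ps_coef ((1 - psX) ^+ n.+1) 0).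
  have -> : 1 - psX = ps_poly (1 - 'X) by rewrite rmorphB rmorph1.
  by rewrite -rmorphXn /= -horner_coef0 horner_exp !hornerE ?subr0 ?expr1n mul1r.
- move=> i j ij ijd; rewrite !hp; apply: (sym_unimodal_ge0_near HpS); lia.
Qed.

(** The constant coefficient is the count at 0; its positivity makes the symmetric top coefficient
    nonzero, so the degree is exact. *)
Lemma ehrhart_series_even : (0 < ehrhart_count P 0)%N -> exists h : {poly rat},
  [/\ ps_eq_frac (ehrhart_series P) h ((1 - 'X) ^+ (n + 1)%N),
      size h = (b.+1 * (m - 2)).+1, palindromic h & unimodal h].
Proof.
move=> L0; have [h [h_frac h_hi h_sym h0 h_mono]] := ehrhart_numerator_even.
set d := (b.+1 * (m - 2))%N in h_hi h_sym h_mono *.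
have sz : size h = d.+1.
  apply/anti_leq/andP; split; first by apply/leq_sizeP => j; exact: h_hi.
  rewrite ltnNge; apply/negP => /leq_sizeP /(_ d (leqnn d)).
  by rewrite h_sym // subnn h0 => /eqP; rewrite pnatr_eq0 gtn_eqF.
exists h; split=> // [z z0|].
  rewrite sz /= !horner_coef sz mulr_sumr (reindex_inj rev_ord_inj) /=.
  apply: eq_bigr => i _; have id : (i <= d)%N by rewrite -ltnS.
  by rewrite subSS -h_sym // mulrCA exprVn expfB_cond // ?(negPf z0).
exists d./2; split=> i j; rewrite sz => /andP [ij jk] jd.
  by apply: h_mono; lia.
move: jk; rewrite leq_eqVlt => /predU1P [-> //|ij'].
by rewrite (h_sym j) //; apply: h_mono; lia.
Qed.

End EhrhartEven.

(** * Ehrhart quasipolynomial and its reciprocity *)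

Section EhrhartQuasi.
Variables (R : realType) (m b : nat).
Local Notation Y := ('I_m * 'I_b.+1 * bool)%type.
Local Notation ty := (@signed_type m b \o @id Y).
Local Notation ideal := (signed_ideal (@id Y)).
Local Notation n := (b.+1 * m)%N.

(** The walks gain one step per unit of [z], against two when all slots are read; the parity of [z]
    then matters because types alternate. *)
Definition ehrhart_fun (z : int) : rat :=
  \sum_(S : {set Y} | (S \in ideal) && (#|S| == #|{: 'I_m * 'I_b.+1}|))
    walkz ty ideal (z + b.+1%:Z) S.

Lemma ehrhart_fun_count (q : nat) : ehrhart_fun q = (L_cyc R m b.+1 q)%:R.
Proof. by rewrite /L_cyc ehrhart_count_slots card_slots_signed. Qed.

(** Reciprocity holds term by term: all final sets have the same cardinality, hence the same
    sign. *)
Lemma ehrhart_fun_reciprocity (q : int) :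
  ehrhart_fun (- q) = (-1) ^+ n * ehrhart_fun (q - (2 * b.+1 + 1)%N%:Z).
Proof.
rewrite /ehrhart_fun mulr_sumr; apply: eq_bigr => S /andP [_ /eqP Sc].
have -> : - q + b.+1%:Z = - (q - b.+1%:Z) by rewrite opprB addrC.
rewrite walkz_reflect Sc card_prod !card_ord mulnC; congr (_ * walkz _ _ _ _).
by lia.
Qed.

Lemma ehrhart_fun_quasipolynomial : quasipolynomial 2 ehrhart_fun.
Proof.
have [p Ep] : exists p : bool -> {poly rat}, forall (c : bool) (t : int),
    ehrhart_fun (t * 2 + c%:Z - b.+1%:Z) = (p c).[t%:~R].
  have F (c : bool) : polyfun (fun t => ehrhart_fun (t * 2 + c%:Z - b.+1%:Z)).
    apply: polyfun_sum => S /andP [SI _].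
    under eq_fun do rewrite subrK.
    apply: (walkz_polyfun _ _ _ c SI).
    - exact: signed_ideal_between.
    - exact: signed_ideal0.
    - exact/signed_ideal_true/signed_below.
  have [p0 E0] := F false; have [p1 E1] := F true.
  by exists (fun c => if c then p1 else p0) => -[].
(* The walks have [z + b + 1] steps, so the parity of this number selects the polynomial. *)
pose par (r : int) := odd `|(r + b.+1%:Z)%R|%N.
exists (fun r => p (par r) \Po (2^-1 *: ('X + (b.+1%:R - (par r)%:R)%:P))) => z.
set r := (z %% 2)%Z.
have [t Et] : exists t : int, z + b.+1%:Z = t * 2 + (par r)%:Z.
  exists ((z + b.+1%:Z) %/ 2)%Z.
  rewrite [LHS](divz_eq _ 2); congr (_ + _).
  by rewrite /par /r; lia.
have -> : z = t * 2 + (par r)%:Z - b.+1%:Z by rewrite -Et addrK.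
rewrite Ep horner_comp hornerZ hornerD hornerX hornerC; congr (_.[_]).
rewrite intrB intrD intrM -!pmulrn; lra.
Qed.

(** Reciprocity at every integer lets one polynomial represent both sides. *)
Lemma ehrhart_fun_constituents (e : int) : exists f g : {poly rat},
  [/\ forall q : int, (q = e %[mod 2])%Z -> ehrhart_fun (- q) = f.[q%:~R] /\
        (-1) ^+ n * ehrhart_fun (q - (2 * b.+1 + 1)%N%:Z) = g.[q%:~R],
      forall q : int, (q = e %[mod 2])%Z ->
        (2 * b.+1 + 1)%N%:Z <= q -> f.[q%:~R] = g.[q%:~R]
    & f = g].
Proof.
have [c Ec] := ehrhart_fun_quasipolynomial.
pose f := c ((- e) %% 2)%Z \Po (- 'X).
have fE q : (q = e %[mod 2])%Z -> ehrhart_fun (- q) = f.[q%:~R].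
  move=> qe; rewrite Ec (_ : ((- q) %% 2 = (- e) %% 2)%Z); last by lia.
  by rewrite /f horner_comp !hornerE rmorphN.
exists f, f; split=> // q qe; split; first exact: fE.
by rewrite -fE // ehrhart_fun_reciprocity.
Qed.

End EhrhartQuasi.

(** * Polytopes given by inequalities *)

Local Open Scope classical_set_scope.

Section DotProduct.
Variables (R : realType) (r s : nat).
Implicit Types u x y : 'M[R]_(r, s).

Lemma dotpC u x : dotp u x = dotp x u.
Proof. by apply: eq_bigr => i _; apply: eq_bigr => j _; rewrite mulrC. Qed.

Lemma dotpD u x y : dotp u (x + y) = dotp u x + dotp u y.
Proof.
rewrite /dotp -big_split; apply: eq_bigr => i _; rewrite -big_split.
by apply: eq_bigr => j _; rewrite mxE mulrDr.
Qed.

Lemma dotpZ u c x : dotp u (c *: x) = c * dotp u x.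
Proof.
rewrite /dotp mulr_sumr; apply: eq_bigr => i _; rewrite mulr_sumr.
by apply: eq_bigr => j _; rewrite mxE mulrCA.
Qed.

Lemma dotpB u x y : dotp u (x - y) = dotp u x - dotp u y.
Proof. by rewrite dotpD -scaleN1r dotpZ mulN1r. Qed.

Lemma dotp0 u : dotp u 0 = 0.
Proof. by rewrite -(scale0r 0) dotpZ mul0r. Qed.

Fact dotp_is_semilinear u : semilinear (dotp u : 'M[R]_(r, s) -> R^o).
Proof. by split=> [c x|x y]; rewrite ?dotpZ ?dotpD. Qed.
HB.instance Definition _ u :=
  GRing.isSemilinear.Build R 'M[R]_(r, s) R^o *%R (dotp u) (dotp_is_semilinear u).

Lemma dotp_delta u i j : dotp u (delta_mx i j) = u i j.
Proof.
rewrite /dotp (bigD1 i) //= (bigD1 j) //= mxE !eqxx mulr1.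
rewrite big1 => [|j' /negPf jj']; last by rewrite mxE jj' andbF mulr0.
rewrite addr0 big1 ?addr0 // => i' /negPf ii'.
by rewrite big1 // => j' _; rewrite mxE ii' mulr0.
Qed.

Lemma dotp_eq0 u : (forall x, dotp u x = 0) -> u = 0.
Proof. by move=> u0; apply/matrixP => i j; rewrite -dotp_delta u0 mxE. Qed.

Definition dotp_hom u : 'Hom('M[R]_(r, s), R^o) := linfun (dotp u).

Lemma mem_lker_dotp u x : (x \in lker (dotp_hom u)) = (dotp u x == 0).
Proof. by rewrite memv_ker lfunE. Qed.

Lemma dim_lker_dotp u : u != 0 -> (\dim (lker (dotp_hom u)) < r * s)%N.
Proof.
have E : \dim {: 'M[R]_(r, s)} = (r * s)%N by rewrite dimvf; exact: dim_matrix.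
move=> u0; rewrite -E ltn_neqAle dimvS ?subvf // andbT.
apply: contraNneq u0 => E'; apply/eqP/dotp_eq0 => x; apply/eqP.
rewrite -mem_lker_dotp; suff -> : lker (dotp_hom u) = fullv by rewrite memvf.
by apply/eqP; rewrite eqEdim subvf E' leqnn.
Qed.

End DotProduct.

(** The step is the inverse of one plus the sum of all ratios [|d k| / sl k]; indices with zero
    slack contribute 0 by the convention on division. *)
Lemma small_step (R : realType) (K : finType) (sl d : K -> R) :
  (forall k, 0 <= sl k) -> (forall k, sl k = 0 -> d k = 0) ->
  exists2 e : R, 0 < e & forall k, e * `|d k| <= sl k.
Proof.
move=> sl0 d0; pose S := \sum_k `|d k| / sl k.
have S0 : 0 <= S by apply: sumr_ge0 => k _; rewrite divr_ge0.
exists (1 + S)^-1 => [|k]; first by rewrite invr_gt0; lra.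
have [sk|sk] := eqVneq (sl k) 0; first by rewrite d0 // normr0 mulr0.
have skp : 0 < sl k by rewrite lt_neqAle eq_sym sk sl0.
rewrite mulrC ler_pdivrMr; last by lra.
rewrite -ler_pdivrMl // mulrC.
suff : `|d k| / sl k <= S by lra.
by rewrite /S (bigD1 k) //= lerDl sumr_ge0 // => i _; rewrite divr_ge0.
Qed.

Section HPolytope.
Variables (R : realType) (r s : nat) (K : finType).
Variables (nv : K -> 'M[R]_(r, s)) (beta : K -> R).
Let P : set 'M[R]_(r, s) := [set x | forall k, dotp (nv k) x <= beta k].

Lemma feasible_direction (x D : 'M[R]_(r, s)) : P x ->
  (forall k, dotp (nv k) x = beta k -> dotp (nv k) D = 0) ->
  exists2 e : R, 0 < e & P (x + e *: D) /\ P (x - e *: D).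
Proof.
move=> Px tight.
have [|k /subr0_eq /esym /tight //|e e0 He] :=
  @small_step R K (fun k => beta k - dotp (nv k) x) (fun k => dotp (nv k) D).
  by move=> k; rewrite subr_ge0.
exists e => //; split=> k; have := He k; rewrite -(gtr0_norm e0) -normrM ler_norml.
  by move=> /andP [_ H]; rewrite dotpD dotpZ (gtr0_norm e0) in H *; lra.
by move=> /andP [H _]; rewrite dotpB dotpZ (gtr0_norm e0) in H *; lra.
Qed.

(** Otherwise both ends of a short segment through [v] would lie in the polytope and attain the
    maximum that singles out [v]. *)
Lemma vertex_direction (v D : 'M[R]_(r, s)) : vertex P v ->
  (forall k, dotp (nv k) v = beta k -> dotp (nv k) D = 0) -> D = 0.
Proof.
move=> [u [c [uc /seteqP [vF Fv]]]] tight.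
have [Pv uv] := vF v erefl.
have [e e0 [P1 P2]] := feasible_direction Pv tight.
have := uc _ P1; have := uc _ P2; rewrite dotpB dotpD uv => le1 le2.
have : (v + e *: D) = v by apply: Fv; split=> //; rewrite dotpD uv; lra.
move/(canRL (addKr v)); rewrite addNr => /eqP.
by rewrite scaler_eq0 gt_eqF //= => /eqP.
Qed.

End HPolytope.

Lemma affine_dim_unique (R : realType) r s (P : set 'M[R]_(r, s)) d d' :
  affine_dim P d -> affine_dim P d' -> d = d'.
Proof.
move=> [_ [U [PU Umin <-]]] [_ [V [PV Vmin <-]]].
by apply/anti_leq/andP; split; apply: dimvS; [apply: Umin|apply: Vmin].
Qed.

Lemma full_dimensionalP (R : realType) r s (P : set 'M[R]_(r, s)) x : P x ->
  (forall D, exists2 e : R, 0 < e & P (x + e *: D)) -> full_dimensional P.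
Proof.
move=> Px H; split; first by exists x.
exists fullv; split=> [y z _ _|W HW|]; first exact: memvf.
  apply/subvP => D _; have [e e0 PD] := H D.
  by have := HW _ _ PD Px; rewrite addrAC subrr add0r rpredZeq gt_eqF.
by rewrite dimvf; exact: dim_matrix.
Qed.

(** A facet lies in one of the hyperplanes of the given normals, since otherwise it would contain a
    point strictly inside all of them; by dimension it then spans that hyperplane and is the whole
    face cut out by it. *)
Lemma reflexive_of_normals (R : realType) r s (K : finType) (k0 : K)
    (n : K -> 'M[int]_(r, s)) : (forall k, primitive_mx (n k)) ->
  reflexive_polytope [set y : 'M[R]_(r, s) | forall k, dotp (int_mx (n k)) y <= 1].
Proof.
move=> n_prim; set P := [set y | _] => F [[u [c [uc FE]]] [d [Fd Pd]]].
have [f0 Ff0] : F !=set0 by case: Fd.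
have full : full_dimensional P.
  apply: (@full_dimensionalP _ _ _ _ 0) => [k|D]; first by rewrite dotp0 ler01.
  have [k|k|e e0 [He _]] := @feasible_direction R r s K (fun k => int_mx (n k)) (fun=> 1) 0 D.
  - by rewrite dotp0 ler01.
  - by rewrite dotp0 => /esym /eqP; rewrite oner_eq0.
  - by exists e.
have rsd : (r * s)%N = d.+1 := affine_dim_unique full Pd.
have u0 : u != 0.
  apply/eqP => u0; have FP : F = P.
    rewrite FE; apply/seteqP; split=> [x [] //|x Px]; split=> //.
    move: Ff0; rewrite FE => -[_ <-]; rewrite u0.
    by rewrite /dotp !big1 // => i _; rewrite big1 // => j _; rewrite mxE mul0r.
  by rewrite FP in Fd; have /n_Sn := affine_dim_unique Fd Pd.
have [k Hk] : exists k, forall f, F f -> dotp (int_mx (n k)) f = 1.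
  apply: contrapT => /forallNP H.
  have {H} /choice [f Hf] : forall k, exists f, F f /\ dotp (int_mx (n k)) f < 1.
    move=> k; have /existsNP [f /not_implyP [Ff nf]] := H k; exists f; split=> //.
    rewrite lt_neqAle; apply/andP; split; first exact/eqP.
    by move: Ff; rewrite FE => -[/(_ k)].
  (* The barycentre of the witnesses stays in the face and satisfies every inequality strictly. *)
  pose g := (#|K|%:R^-1 : R) *: \sum_k f k.
  have K0 : 0 < #|K|%:R :> R by rewrite ltr0n; apply/card_gt0P; exists k0.
  have dotg v : dotp v g = #|K|%:R^-1 * \sum_k dotp v (f k).
    by rewrite /g dotpZ (linear_sum (dotp v)).
  have gn k : dotp (int_mx (n k)) g < 1.
    rewrite dotg mulrC ltr_pdivrMr // mul1r -subr_gt0 -sumr_const -sumrB.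
    rewrite (bigD1 k) //= ltr_pwDl //; first by rewrite subr_gt0; case: (Hf k).
    by apply: sumr_ge0 => j _; rewrite subr_ge0; case: (Hf j); rewrite FE => -[/(_ k)].
  have ug : dotp u g = c.
    rewrite dotg; under eq_bigr => j _ do
      (rewrite (_ : dotp u (f j) = c); last by (case: (Hf j); rewrite FE => -[])).
    by rewrite sumr_const -[c *+ _]mulr_natr mulrCA mulVf ?mulr1 // gt_eqF.
  case/eqP: u0; apply: dotp_eq0 => D.
  have [j|j|e e0 [P1 P2]] := @feasible_direction R r s K (fun k => int_mx (n k)) (fun=> 1) g D.
  - exact: ltW.
  - by move=> E; have := gn j; rewrite E ltxx.
  have := uc _ P1; have := uc _ P2; rewrite dotpB dotpD dotpZ ug => le1 le2.
  have /eqP : e * dotp u D = 0 by lra.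
  by rewrite mulf_eq0 gt_eqF //= => /eqP.
exists (n k); split=> [//|y Py|]; first exact: Py.
apply/seteqP; split=> [f Ff|y [Py ny]].
  by split; [move: Ff; rewrite FE => -[]|exact: Hk].
have n0 : int_mx (n k) != 0 :> 'M[R]_(r, s).
  apply/eqP => n0; have := Hk _ Ff0; rewrite n0 /dotp big1 => [/esym/eqP|i _].
    by rewrite oner_eq0.
  by rewrite big1 // => j _; rewrite mxE mul0r.
have [_ [U [FU Umin dimU]]] := Fd.
(* By dimension, the kernel of any nonzero functional constant on [F] is the direction space of
   [F]. *)
have lkerE (w : 'M[R]_(r, s)) : w != 0 -> (forall x z, F x -> F z -> dotp w x = dotp w z) ->
    U = lker (dotp_hom w).
  move=> w0 Hw; apply/eqP; rewrite eqEdim Umin => [|x z Fx Fz]; last first.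
    by rewrite mem_lker_dotp dotpB (Hw x z) // subrr.
  by rewrite dimU -ltnS -rsd dim_lker_dotp.
have Uu : U = lker (dotp_hom u).
  by apply: lkerE => // x z; rewrite FE => -[_ ->] [_ ->].
have Un : U = lker (dotp_hom (int_mx (n k))).
  by apply: lkerE => // x z Fx Fz; rewrite !Hk.
have : y - f0 \in lker (dotp_hom u).
  by rewrite -Uu Un mem_lker_dotp dotpB ny Hk // subrr.
rewrite mem_lker_dotp dotpB subr_eq0 => /eqP uy.
by rewrite FE; split=> //; rewrite uy; move: Ff0; rewrite FE => -[].
Qed.

(** * Geometry of the cyclic block polytope *)

Section CyclicGeometry.
Variables (R : realType) (m a : nat).
Local Notation cyc := (cyc_block R m a).
Implicit Types (x v : 'M[R]_(m, a)) (c : R).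

Definition cyc_normal (k : 'I_m * 'I_a + 'I_m) : 'M[int]_(m, a) :=
  match k with
  | inl (i, j) => - delta_mx i j
  | inr i => \matrix_(i', j) ((i' == i)%:R + (i' == ordS i)%:R)
  end.

Definition cyc_bound c (k : 'I_m * 'I_a + 'I_m) : R := if k is inr _ then c else 0.

Lemma dotp_cyc_normal x k : dotp (int_mx (cyc_normal k)) x =
  match k with
  | inl (i, j) => - x i j
  | inr i => row_sum x i + row_sum x (ordS i)
  end.
Proof.
case: k => [[i j]|i] /=.
  have -> : int_mx (- delta_mx i j) = - delta_mx i j :> 'M[R]_(m, a).
    by rewrite /int_mx map_mxN map_delta_mx.
  by rewrite dotpC -scaleN1r dotpZ mulN1r dotp_delta.
have pick (k : 'I_m) : \sum_i' \sum_j (i' == k)%:R * x i' j = row_sum x k.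
  rewrite (bigD1 k) //= [X in _ + X]big1 => [|i' /negPf ik].
    by rewrite addr0 /row_sum; apply: eq_bigr => j _; rewrite eqxx mul1r.
  by rewrite big1 // => j _; rewrite ik mul0r.
rewrite -!pick -big_split; apply: eq_bigr => i' _; rewrite -big_split.
by apply: eq_bigr => j _; rewrite !mxE intrD !mulrz_nat mulrDl.
Qed.

Lemma cyc_blockE c : cyc c = [set x | forall k, dotp (int_mx (cyc_normal k)) x <= cyc_bound c k].
Proof.
apply/seteqP; split=> [x [x0 xc] [[i j]|i]|x H]; rewrite ?dotp_cyc_normal //=.
  by rewrite oppr_le0.
split=> [i j|i]; first by have := H (inl (i, j)); rewrite dotp_cyc_normal /= oppr_le0.
by have := H (inr i); rewrite dotp_cyc_normal.
Qed.

Lemma bounded_cyc_block c : bounded_set (cyc c).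
Proof.
exists `|c|; split=> [|M cM x xc]; first exact: num_real.
rewrite /= (_ : `|x| = mx_norm x) // mx_normrE; apply: bigmax_le => [|[i j] _ /=].
  exact: le_trans (normr_ge0 c) (ltW cM).
rewrite ger0_norm; last by case: xc.
exact: le_trans (cyc_block_le i j xc) (le_trans (ler_norm c) (ltW cM)).
Qed.

Lemma rational_cyc_block (k : nat) : rational_polytope (cyc k%:R).
Proof.
split; first exact: bounded_cyc_block.
exists [seq (cyc_normal t, if t is inr _ then k%:Z else 0) | t <- enum {: 'I_m * 'I_a + 'I_m}].
rewrite cyc_blockE; apply/seteqP; split=> x H.
  by move=> _ /mapP [t _ ->]; have := H t; case: t.
move=> t; have := H _ (map_f _ (mem_enum _ t)); rewrite /=.
by case: t.
Qed.

Definition psum x (i : 'I_m) (k : nat) : R := \sum_(l < a | (l < k)%N) x i l.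

Lemma psum0 x i : psum x i 0 = 0.
Proof. by rewrite /psum big_pred0. Qed.

Lemma psum_max x i : psum x i a = row_sum x i.
Proof. by apply: eq_bigl => l; rewrite ltn_ord. Qed.

Lemma psumS x i (j : 'I_a) : psum x i j.+1 = psum x i j + x i j.
Proof.
rewrite /psum (bigD1 j) //= addrC; congr (_ + _); apply: eq_bigl => l.
by rewrite -val_eqE /=; lia.
Qed.

(* Moving the partial sums of [v] in the direction [W] respects all the
   constraints that are tight at [v]. *)
Lemma vertex_psum c v (W : 'I_m -> R -> R) : vertex (cyc c) v ->
  (forall i, W i 0 = 0) -> (forall i s, W i s + W (ordS i) (c - s) = 0) ->
  forall i k, (k <= a)%N -> W i (psum v i k) = 0.
Proof.
rewrite cyc_blockE => vv W0 Ws.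
pose D : 'M[R]_(m, a) := \matrix_(i, j) (W i (psum v i j.+1) - W i (psum v i j)).
have rsD i : row_sum D i = W i (row_sum v i).
  rewrite /row_sum; under eq_bigr do rewrite mxE.
  rewrite -(big_mkord xpredT (fun j => W i (psum v i j.+1) - W i (psum v i j))).
  by rewrite telescope_sumr // psum0 W0 subr0 psum_max.
have D0 : D = 0.
  apply: (vertex_direction vv) => -[[i j]|i]; rewrite !dotp_cyc_normal /=.
    by move/eqP; rewrite oppr_eq0 => /eqP vij; rewrite mxE psumS vij addr0 subrr oppr0.
  move=> E; rewrite !rsD; have := Ws i (row_sum v i).
  by rewrite -{1}E (addrC (row_sum v i)) addrK.
move=> i; elim=> [|k IHk] ka; first by rewrite psum0.
have := congr1 (fun A : 'M[R]_(m, a) => A i (Ordinal ka)) D0.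
by rewrite !mxE /= IHk ?subr0 // ltnW.
Qed.

Lemma lattice_psum v : (forall i k, (k <= a)%N -> psum v i k \is a Num.int) -> lattice v.
Proof.
move=> H; apply/mxOverP => i j.
have -> : v i j = psum v i j.+1 - psum v i j by rewrite psumS addrC addKr.
by rewrite rpredB // H // ltnW.
Qed.

End CyclicGeometry.

(** * Integrality of vertices *)

Section CyclicLattice.
Variables (R : realType) (m a : nat).
Local Notation cyc := (cyc_block R m a).
Local Notation P := (cyclic_block_polytope R m a).

(** Partial sums equal to a non-integral [t] or to [1 - t] can be moved together, with signs
    alternating by row; the signs match around the cycle since [m] is even. *)
Lemma lattice_cyc_even : ~~ odd m -> lattice_polytope P.
Proof.
move=> m_even; split; first exact: (rational_cyc_block R m a 1).
move=> v vv; apply: lattice_psum => i0 k0 ka.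
set t := psum v i0 k0; apply: contrapT => t_int.
have t0 : t != 0 by apply/eqP => t0; apply: t_int; rewrite t0 int_num0.
have t1 : 1 - t != 0.
  by rewrite subr_eq0; apply/eqP => t1; apply: t_int; rewrite -t1 int_num1.
pose W (i : 'I_m) (s : R) : R := (-1) ^+ i * ((s == t)%:R + (s == 1 - t)%:R).
have := @vertex_psum R m a 1 v W vv.
have W0 i : W i 0 = 0.
  by rewrite /W ![0 == _]eq_sym (negPf t0) (negPf t1) addr0 mulr0.
have Ws i s : W i s + W (ordS i) (1 - s) = 0.
  rewrite /W -(signr_odd _ (ordS i)) odd_ordS // -(signr_odd _ i) signrN.
  have -> : (1 - s == t) = (s == 1 - t) by apply/eqP/eqP => ?; lra.
  have -> : (1 - s == 1 - t) = (s == t) by rewrite (inj_eq (addrI 1)) eqr_opp.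
  by rewrite mulNr [X in _ - _ * X]addrC subrr.
move=> /(_ W0 Ws i0 k0 ka) /eqP; rewrite /W -/t eqxx mulf_eq0 signr_eq0 /=.
by rewrite -natrD pnatr_eq0.
Qed.

(** In the doubled polytope the values [t] and [2 - t] move in opposite directions in every row, so
    tight pairs of rows compensate; the two values differ because [t] is not 1. *)
Lemma lattice_cyc_double : lattice_polytope (dilate 2 P).
Proof.
rewrite dilate_cyclic; split; first exact: rational_cyc_block.
move=> v vv; apply: lattice_psum => i0 k0 ka.
set t := psum v i0 k0; apply: contrapT => t_int.
have tn (n : nat) : t != n%:R by apply/eqP => tn; apply: t_int; rewrite tn natr_int.
pose W (i : 'I_m) (s : R) : R := (s == t)%:R - (s == 2 - t)%:R.
have W0 i : W i 0 = 0.
  rewrite /W ![0 == _]eq_sym (negPf (tn 0)) subr_eq0 eq_sym (negPf (tn 2)); exact: subrr.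
have Ws i s : W i s + W (ordS i) (2 - s) = 0.
  rewrite /W.
  have -> : (2 - s == t) = (s == 2 - t) by apply/eqP/eqP => ?; lra.
  have -> : (2 - s == 2 - t) = (s == t) by rewrite (inj_eq (addrI _)) eqr_opp.
  by rewrite addrA subrK subrr.
have := vertex_psum vv W0 Ws i0 ka; rewrite /W -/t eqxx.
have -> : (t == 2 - t) = false.
  by apply/negbTE/eqP => E; have /eqP := tn 1; apply; lra.
by move/eqP; rewrite subr0 oner_eq0.
Qed.

Lemma sum_row_sum_ordS (x : 'M[R]_(m, a)) :
  \sum_i row_sum x (ordS i) = \sum_i row_sum x i.
Proof. by rewrite [RHS](reindex_inj (@ordS_inj m)). Qed.

Lemma sum_row_sum_le c (x : 'M[R]_(m, a)) : cyc c x ->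
  2 * \sum_i row_sum x i <= m%:R * c.
Proof.
move=> [_ xc]; rewrite mulr_natl mulr2n -{2}sum_row_sum_ordS -big_split /=.
apply: le_trans (ler_sum _ (fun i _ => xc i)) _.
by rewrite sumr_const card_ord mulr_natl.
Qed.

End CyclicLattice.

(** On the polytope [u] is at most [m / 2]. Equality kills all entries outside the first column and
    makes all cyclic inequalities tight, which on an odd cycle forces row sums [1/2]. *)
Lemma half_vertex (R : realType) m b : odd m ->
  vertex (cyclic_block_polytope R m b.+1) (\matrix_(i, j) (if j == ord0 then 2^-1 else 0)).
Proof.
move=> m_odd; set v := (X in vertex _ X).
pose u : 'M[R]_(m, b.+1) := \matrix_(i, j) (if j == ord0 then 1 else -1).
have rsv i : row_sum v i = 2^-1.
  rewrite /row_sum (bigD1 ord0) //= mxE eqxx big1 ?addr0 // => j /negPf j0.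
  by rewrite mxE j0.
have dotu (x : 'M[R]_(m, b.+1)) :
    dotp u x = \sum_i row_sum x i - 2 * \sum_i \sum_(j | j != ord0) x i j.
  rewrite /dotp mulr_sumr -sumrB; apply: eq_bigr => i _.
  rewrite /row_sum (bigD1 ord0) //= [\sum_j x i j](bigD1 ord0) //= mxE eqxx mul1r mulr_sumr -addrA.
  congr (_ + _).
  rewrite -sumrB; apply: eq_bigr => j /negPf j0; rewrite mxE j0; ring.
have vP : cyclic_block_polytope R m b.+1 v.
  split=> [i j|i]; last by rewrite !rsv; lra.
  by rewrite mxE; case: ifP => // _; lra.
have dotv : dotp u v = m%:R / 2.
  rewrite dotu [X in _ - 2 * X]big1 => [|i _]; last first.
    by rewrite big1 // => j /negPf j0; rewrite mxE j0.
  rewrite mulr0 subr0; under eq_bigr do rewrite rsv.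
  by rewrite sumr_const card_ord mulr_natl.
exists u, (m%:R / 2); split=> [x xP|].
  have := sum_row_sum_le xP; rewrite dotu mulr1.
  have : 0 <= \sum_i \sum_(j | j != ord0) x i j.
    by apply: sumr_ge0 => i _; apply: sumr_ge0 => j _; case: xP.
  by lra.
apply/seteqP; split=> [_ ->|x [xP ux]]; first by split.
have x0 := proj1 xP.
have s1 := sum_row_sum_le xP; rewrite mulr1 in s1.
have s2i i : 0 <= \sum_(j | j != ord0) x i j by apply: sumr_ge0.
have s2 : 0 <= \sum_i \sum_(j | j != ord0) x i j by apply: sumr_ge0.
rewrite dotu in ux.
have S1 : \sum_i row_sum x i = m%:R / 2 by lra.
have S2 : \sum_i \sum_(j | j != ord0) x i j = 0 by lra.
have xj i j : j != ord0 -> x i j = 0.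
  move=> j0; move/eqP: S2; rewrite psumr_eq0 // => /allP /(_ i (mem_index_enum _)) /=.
  rewrite psumr_eq0 // => /allP /(_ j (mem_index_enum _)); rewrite j0 /=; exact/eqP.
have rs i : row_sum x i = x i ord0.
  by rewrite /row_sum (bigD1 ord0) //= big1 ?addr0 // => j; exact: xj.
have tight i : row_sum x i + row_sum x (ordS i) = 1.
  have : \sum_i (1 - (row_sum x i + row_sum x (ordS i))) = 0.
    rewrite sumrB sumr_const card_ord big_split /= sum_row_sum_ordS S1; lra.
  move/eqP; rewrite psumr_eq0 => [|k _]; last by rewrite subr_ge0; case: xP.
  by move=> /allP /(_ i (mem_index_enum _)) /= /eqP; lra.
have half i : row_sum x i = 2^-1.
  (* The deviation from [1/2] changes sign from row to row, so after an odd cycle it equals its own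
     opposite. *)
  pose d (k : 'I_m) := row_sum x k - 2^-1.
  have m0 : (0 < m)%N by case: (i) => k; case: (m).
  have dS k : d (ordS k) = - d k by rewrite /d; have := tight k; lra.
  have dk (k : 'I_m) : d k = (-1) ^+ k * d (Ordinal m0).
    case: k => k; elim: k => [|k IHk] km.
      by rewrite mul1r; congr d; apply: val_inj.
    have E : Ordinal km = ordS (Ordinal (ltnW km)).
      by apply: val_inj; rewrite /= modn_small.
    by rewrite [in LHS]E dS IHk /= exprS mulN1r mulNr.
  have m1 : (m.-1 < m)%N by rewrite prednK.
  have : d (ordS (Ordinal m1)) = d (Ordinal m0).
    by congr d; apply: val_inj; rewrite /= prednK // modnn.
  rewrite dS dk -signr_odd /= (_ : odd m.-1 = false); last first.
    have mo : odd m.-1.+1 by rewrite prednK.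
    exact: negbTE mo.
  rewrite mul1r => d0; have := dk i; have -> : d (Ordinal m0) = 0 by lra.
  by rewrite mulr0 /d; lra.
apply/matrixP => i j; rewrite mxE; case: eqP => [->|/eqP /xj //].
by rewrite -rs half.
Qed.

Lemma natr_sum_ord (R : pzSemiRingType) n : n%:R = \sum_(j < n) 1 :> R.
Proof. by rewrite sumr_const card_ord. Qed.

Lemma cyc_block_strict_direction (R : realType) m a c (x D : 'M[R]_(m, a)) :
  (forall i j, 0 < x i j) -> (forall i, row_sum x i + row_sum x (ordS i) < c) ->
  exists2 e : R, 0 < e & cyc_block R m a c (x + e *: D).
Proof.
move=> x0 xc; rewrite cyc_blockE.
have [[[i j]|i]|[[i j]|i]|e e0 [He _]] := @feasible_direction R m a _
  (fun k => int_mx (cyc_normal k)) (cyc_bound c) x D.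
- by rewrite dotp_cyc_normal /= oppr_le0 ltW.
- by rewrite dotp_cyc_normal /= ltW.
- by rewrite dotp_cyc_normal /= => /eqP; rewrite oppr_eq0 gt_eqF.
- by rewrite dotp_cyc_normal /= => E; have := xc i; rewrite E ltxx.
- by exists e.
Qed.

Lemma row_sum_const (R : realType) m a (c : R) i : row_sum (const_mx c : 'M[R]_(m, a)) i = a%:R * c.
Proof.
by rewrite /row_sum; under eq_bigr do rewrite mxE; rewrite sumr_const card_ord mulr_natl.
Qed.

Lemma full_dimensional_cyc (R : realType) m a : full_dimensional (cyclic_block_polytope R m a).
Proof.
have a0 : 0 <= a%:R :> R by [].
pose e : R := (2 * a%:R + 1)^-1.
have e0 : 0 < e by rewrite invr_gt0; lra.
have ae : 2 * a%:R * e < 1 by rewrite /e ltr_pdivrMr; lra.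
apply: (@full_dimensionalP _ _ _ _ (const_mx e)) => [|D].
  by split=> [i j|i]; rewrite ?mxE ?row_sum_const; lra.
apply: cyc_block_strict_direction => [i j|i]; first by rewrite mxE.
by rewrite !row_sum_const; lra.
Qed.

(** * Interior points of the dilates *)

Section InteriorPoints.
Variables (R : realType) (m a : nat).
Local Notation P := (cyclic_block_polytope R m a).

Lemma interior_line (A : set 'M[R]_(m, a)) x D : interior A x ->
  exists2 e : R, 0 < e & A (x + e *: D).
Proof.
move=> /nbhs_ballP [e /= e0 He].
pose S := 1 + \sum_i \sum_j `|D i j|.
have S1 : 1 <= S by rewrite lerDl; apply: sumr_ge0 => i _; apply: sumr_ge0.
exists (e / S); first by rewrite divr_gt0 //; lra.
apply: He; split=> // i j; rewrite -ball_normE /= !mxE opprD addrA subrr add0r normrN normrM.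
rewrite gtr0_norm ?divr_gt0 //; last by lra.
rewrite mulrAC ltr_pdivrMr ?ltr_pM2l //; last by lra.
rewrite /S (bigD1 i) //= (bigD1 j) //= addrA addrA.
have : 0 <= \sum_(k | k != j) `|D i k| by apply: sumr_ge0.
have : 0 <= \sum_(k | k != i) \sum_l `|D k l| by apply: sumr_ge0 => k _; apply: sumr_ge0.
by lra.
Qed.

Lemma interior_cyc_block c x : interior (cyc_block R m a c) x -> (0 < a)%N ->
  (forall i j, 0 < x i j) /\ (forall i, row_sum x i + row_sum x (ordS i) < c).
Proof.
move=> xi a0; split=> [i j|i].
  have [e e0 [H _]] := interior_line (- const_mx 1) xi.
  by have := H i j; rewrite !mxE; lra.
have [e e0 [_ H]] := interior_line (const_mx 1) xi.
have := H i; rewrite !row_sumD !row_sumZ !row_sum_const mulr1.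
have : 0 < e * a%:R by rewrite mulr_gt0 // ltr0n.
by lra.
Qed.

Lemma interior_lattice_ge1 c x : interior (cyc_block R m a c) x -> (0 < a)%N -> lattice x ->
  forall i j, 1 <= x i j.
Proof.
move=> xi a0 /mxOverP xl i j; have [x0 _] := interior_cyc_block xi a0.
by have := x0 i j; have /intrP [z ->] := xl i j; rewrite ltr0z ler1z.
Qed.

Lemma interior_ones : interior (cyc_block R m a (2 * a + 1)%N%:R) (const_mx 1).
Proof.
(* The radius satisfies [2 a (1 + e) < 2 a + 1], so both kinds of inequality survive. *)
apply/nbhs_ballP; pose e : R := (2 * a%:R + 1)^-1.
have a0 : 0 <= a%:R :> R by [].
have e0 : 0 < e by rewrite invr_gt0; lra.
have ae : 2 * a%:R * e < 1 by rewrite /e ltr_pdivrMr; lra.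
have e1 : e <= 1 by rewrite invf_le1; lra.
exists e => //= y [_ By].
have yb i j : `|1 - y i j| < e by have := By i j; rewrite -ball_normE /= mxE.
have rs i : row_sum y i <= a%:R * (1 + e).
  rewrite natr_sum_ord mulr_suml; apply: ler_sum => j _.
  by have := yb i j; rewrite ltr_norml => /andP []; lra.
split=> [i j|i]; first by have := yb i j; rewrite ltr_norml => /andP []; lra.
by have := rs i; have := rs (ordS i); rewrite natrD natrM; lra.
Qed.

End InteriorPoints.

(** * Codegree, reflexivity and denominator *)

Section Gorenstein.
Variables (R : realType) (m b : nat).
Hypotheses (m2 : (1 < m)%N).
Local Notation P := (cyclic_block_polytope R m b.+1).
Local Notation cd := (2 * b.+1 + 1)%N.

Let i0 : 'I_m := Ordinal (ltnW m2).

(** Interior lattice points have entries at least 1; an entry 2 would raise two adjacent row sums to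
    [2 (b + 1) + 1], against the strict inequality. *)
Lemma interior_lattice_cd :
  interior (dilate cd P) `&` lattice = [set const_mx 1 : 'M[R]_(m, b.+1)].
Proof.
rewrite dilate_cyclic; apply/seteqP; split=> [x [xi xl]|_ ->]; last first.
  by split; [exact: interior_ones|apply/mxOverP => i j; rewrite mxE int_num1].
have x1 := interior_lattice_ge1 xi isT xl; have [_ xc] := interior_cyc_block xi isT.
have rs i : b.+1%:R <= row_sum x i.
  by rewrite natr_sum_ord; apply: ler_sum => j _.
apply/matrixP => i j; rewrite mxE; apply/eqP; rewrite eq_le x1 andbT leNgt; apply/negP => xij.
have xij2 : 2 <= x i j.
  move: xij; have /mxOverP /(_ i j) /intrP [z ->] := xl.
  by rewrite ltr1z -[2]/(2%:~R) ler_int; lia.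
have rsi : b.+1%:R + 1 <= row_sum x i.
  rewrite /row_sum natr_sum_ord (bigD1 j) //= [\sum_l x i l](bigD1 j) //=.
  have : \sum_(k < b.+1 | k != j) 1 <= \sum_(k < b.+1 | k != j) x i k by apply: ler_sum.
  by lra.
by have := rs (ordS i); have := xc i; rewrite natrD natrM; lra.
Qed.

Lemma codegree_cyc : lattice_polytope P -> codegree P cd.
Proof.
move=> Plat; split=> //; first exact: full_dimensional_cyc.
- by rewrite interior_lattice_cd; exists (const_mx 1).
move=> c c0 [x []]; rewrite dilate_cyclic => xi xl.
have x1 := interior_lattice_ge1 xi isT xl; have [_ xc] := interior_cyc_block xi isT.
have rs i : b.+1%:R <= row_sum x i.
  by rewrite natr_sum_ord; apply: ler_sum => j _.
rewrite addn1 -(ltr_nat R) natrM.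
by have := rs i0; have := rs (ordS i0); have := xc i0; lra.
Qed.

Lemma primitive_mx_unit r s (n : 'M[int]_(r, s)) i j : `|n i j|%N = 1%N -> primitive_mx n.
Proof.
move=> nij; apply/eqP; rewrite -dvdn1; apply: (biggcdn_inf i) => //.
by apply: (biggcdn_inf j) => //; rewrite nij.
Qed.

(** For [m > 1] the rows [i] and [ordS i] differ, so the normal has an entry 1 rather than 2. *)
Lemma primitive_cyc_normal k : primitive_mx (@cyc_normal m b.+1 k).
Proof.
case: k => [[i j]|i] /=.
  by apply: (@primitive_mx_unit _ _ _ i j); rewrite !mxE !eqxx.
apply: (@primitive_mx_unit _ _ _ i ord0); rewrite !mxE eqxx (_ : (i == ordS i) = false) //.
apply/negbTE; rewrite -(inj_eq val_inj) /=; have := ltn_ord i.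
rewrite leq_eqVlt => /predU1P [im|im]; last by rewrite modn_small //; lia.
by rewrite im modnn; move: im m2; lia.
Qed.

(** At the all-ones matrix every normal takes its bound minus 1, so after translation all bounds are
    1. *)
Lemma translate_dilate_cyc :
  translate (- const_mx 1) (dilate cd P) =
  [set y | forall k, dotp (int_mx (@cyc_normal m b.+1 k)) y <= 1].
Proof.
rewrite dilate_cyclic cyc_blockE.
have d1 k : dotp (int_mx (cyc_normal k)) (const_mx 1 : 'M[R]_(m, b.+1)) =
    cyc_bound cd%:R k - 1.
  rewrite dotp_cyc_normal; case: k => [[i j]|i] /=; first by rewrite mxE; lra.
  by rewrite !row_sum_const natrD natrM; lra.
apply/seteqP; split=> [_ [x Hx <-] k|y Hy].
  by rewrite dotpB d1; have := Hx k; lra.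
exists (y + const_mx 1); last by rewrite addrK.
by move=> k; rewrite dotpD d1; have := Hy k; lra.
Qed.

Lemma gorenstein_cyc : lattice_polytope P -> gorenstein P cd.
Proof.
move=> Plat; split=> //; first exact: full_dimensional_cyc.
exists (const_mx 1); split; first exact: interior_lattice_cd.
rewrite translate_dilate_cyc; apply: (reflexive_of_normals (inr i0)) => k.
exact: primitive_cyc_normal.
Qed.

(** Only dilation by 1 has to be excluded, which the half-integral vertex does. *)
Lemma denominator_cyc_odd : odd m -> denominator P 2.
Proof.
move=> m_odd; split=> //; [exact: (rational_cyc_block R m b.+1 1)|exact: lattice_cyc_double|].
move=> [|[|k]] // _; rewrite dilate_cyclic => -[_ /(_ _ (half_vertex R b m_odd))].
move=> /mxOverP /(_ i0 ord0); rewrite mxE eqxx => /intrP [z E].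
have : (1 : int) = z * 2.
  apply: (@intr_inj R); rewrite intrM -E; lra.
by lia.
Qed.

End Gorenstein.

Lemma ehrhart_count0_gt0 (R : realType) m b :
  (0 < ehrhart_count (cyclic_block_polytope R m b.+1) 0)%N.
Proof.
rewrite ehrhart_count_slots -card_lattice_families; apply/card_gt0P.
exists [ffun=> ord0]; rewrite inE; apply/forallP => i.
by rewrite !big1 // => l _; rewrite ffunE.
Qed.

Unset Implicit Arguments.
Local Open Scope ring_scope.

Theorem theorem1p5 (R : realType) (a m : nat) (ha : (1 <= a)%N) (hm : (3 <= m)%N) :
  (~~ odd m ->
    [/\ lattice_polytope (cyclic_block_polytope R m a),
        affine_dim (cyclic_block_polytope R m a) (a * m)%N,
        codegree (cyclic_block_polytope R m a) (2 * a + 1)%N,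
        gorenstein (cyclic_block_polytope R m a) (2 * a + 1)%N
      & (exists h : {poly rat},
          [/\ ps_eq_frac (ehrhart_series (cyclic_block_polytope R m a))
                h ((1 - 'X) ^+ (a * m + 1)%N),
              size h = (a * (m - 2)).+1,
              palindromic h
            & unimodal h])
        /\
        (exists f : {poly rat},
          ehrhart_polynomial (cyclic_block_polytope R m a) f /\
          f \Po (- 'X) = (-1) ^+ (a * m)%N *: (f \Po ('X - (2 * a + 1)%N%:R%:P)))])
  /\
  (odd m ->
    denominator (cyclic_block_polytope R m a) 2 /\
    exists L : int -> rat,
      [/\ forall q : nat, L q%:Z = (L_cyc R m a q)%:R,
          quasipolynomial 2 L,
          forall q : int,
            L (- q) = (-1) ^+ (a * m)%N * L (q - (2 * a + 1)%N%:Z)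
        & forall e : int,
            exists f g : {poly rat},
              [/\ forall q : int, (q = e %[mod 2])%Z ->
                    L (- q) = f.[q%:~R] /\
                    (-1) ^+ (a * m)%N * L (q - (2 * a + 1)%N%:Z) = g.[q%:~R],
                  forall q : int, (q = e %[mod 2])%Z ->
                    (2 * a + 1)%N%:Z <= q -> f.[q%:~R] = g.[q%:~R]
                & f = g]]).
Proof.
have m0 : (0 < m)%N by apply: leq_trans hm.
have m2 : (1 < m)%N by apply: leq_trans hm.
case: a ha => // b _; split=> m_par.
  have lat := lattice_cyc_even R b.+1 m_par.
  split=> //.
  - by rewrite mulnC; exact: full_dimensional_cyc.
  - exact: codegree_cyc.
  - exact: gorenstein_cyc.
  - split; last exact: ehrhart_polynomial_even.
    by apply: ehrhart_series_even => //; exact: ehrhart_count0_gt0.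
split; first exact: denominator_cyc_odd.
exists (ehrhart_fun m b); split.
- exact: ehrhart_fun_count.
- exact: ehrhart_fun_quasipolynomial.
- exact: ehrhart_fun_reciprocity.
- exact: ehrhart_fun_constituents.
Qed.
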